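(* If $\varphi$ is a $\Pi_1^{\mathsf{set}}(\overline{\mathsf{V}})$ sentence, then $$\mathsf{H}^{\omega}\vdash\varphi^{\mathsf{HF}}\iff\mathsf{EA}^{\mathsf{set}}\vdash\varphi.$$
   Context: **The theory $\mathsf{H}^{\omega}$.** Higher-order logic is treated as many-sorted classical first-order logic with equality with sorts (types) $0,1,2,\dots$ and membership predicates $x^{(n)}\mathrel{\varepsilon}y^{(n+1)}$ for all $n$, with the extensionality axioms $\forall z^{(n)}(z^{(n)}\mathrel{\varepsilon}x^{(n+1)}\leftrightarrow z^{(n)}\mathrel{\varepsilon}y^{(n+1)})\to x^{(n+1)}=y^{(n+1)}$ and comprehension $\exists x^{(n+1)}\forall y^{(n)}(y^{(n)}\mathrel{\varepsilon}x^{(n+1)}\leftrightarrow\varphi(y^{(n)}))$ for every higher-order formula $\varphi$ (parameters allowed) in which $x^{(n+1)}$ is not free. $\mathsf{H}^{\omega}$ has in addition a binary predicate $\in$ on type $0$ and a unary function $\overline{\mathsf{V}}$ from type $0$ to type $0$. Lower-case letters denote type-$0$ objects (sets), capital letters type-$1$ objects (classes); $x\subseteq y$ abbreviates $\forall z(z\in x\to z\in y)$. The axioms of $\mathsf{H}^{\omega}$ are: 1. $x=y\leftrightarrow\forall z(z\in x\leftrightarrow z\in y)$; 2. $\exists z\forall w(w\in z\leftrightarrow w\in x\land w\mathrel{\varepsilon}Y)$; 3. $y\in\overline{\mathsf{V}}(x)\leftrightarrow(\exists z\in x)(y\subseteq\overline{\mathsf{V}}(z))$. **The class $\mathsf{HF}$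 in $\mathsf{H}^{\omega}$.** A set is transitive if each of its elements is a subset of it; an ordinal is a transitive set all of whose elements are transitive; $<$ on ordinals is $\in$; $0=\emptyset$; $\beta=S(\alpha)$ iff $\forall x(x\in\beta\leftrightarrow x\in\alpha\lor x=\alpha)$; $\mathsf{Nat}$ is the class of ordinals $\alpha$ such that every ordinal $\beta\le\alpha$ is $0$ or of the form $S(\gamma)$. $\mathsf{HF}$ is the class $\bigcup_{n\in\mathsf{Nat}}\overline{\mathsf{V}}(n)$. $\varphi^{\mathsf{HF}}$ is the relativization of the quantifiers of $\varphi$ to $\mathsf{HF}$ (with $\varphi$ read as a sentence about type-$0$ objects). **The theory $\mathsf{EA}^{\mathsf{set}}$** is the first-order theory with equality in the language $\in$, $\overline{\mathsf{V}}$, $\mathcal{P}$ (the last two unary functions). $\Delta_0^{\mathsf{set}}(\mathcal{P},\overline{\mathsf{V}})$ is the class of formulas in which every quantifier has the form $(\forall x\in t)$ or $(\exists x\in t)$, $t$ a term built from $\mathcal{P}$, $\overline{\mathsf{V}}$ and variables other than $x$. Axioms: 1. $x=y\leftrightarrow\forall z(z\in x\leftrightarrow z\in y)$; 2. $\exists y\forall z(z\in y\leftrightarrow z\in x\land\varphi(z))$, $\varphi\in\Delta_0^{\mathsf{set}}(\mathcal{P},\overline{\mathsf{V}})$, $y$ not free in $\varphi$; 3. $y\in\mathcal{P}(x)\leftrightarrow y\subseteq x$; 4. $y\in\overline{\mathsf{V}}(x)\leftrightarrow(\exists z\in x)\,y\in\mathcal{P}(\overline{\mathsf{V}}(z))$;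 5. (adduction induction) $\exists x(\forall y\,\lnot y\in x\land\varphi(x))\land\forall x,y,z(\varphi(x)\land\varphi(y)\land\forall w(w\in z\leftrightarrow w\in x\lor w=y)\to\varphi(z))\to\forall x\,\varphi(x)$, for $\varphi\in\Delta_0^{\mathsf{set}}(\mathcal{P},\overline{\mathsf{V}})$. **The class $\Pi_1^{\mathsf{set}}(\overline{\mathsf{V}})$** consists of formulas $\forall\vec x\,\psi$ in the language $\in,=,\overline{\mathsf{V}}$ with $\psi\in\Delta_0^{\mathsf{set}}(\overline{\mathsf{V}})$, i.e. all quantifiers of $\psi$ have the form $(\forall x\in t)$ or $(\exists x\in t)$ with $t$ a term built from $\overline{\mathsf{V}}$ and variables other than $x$. *)

(* Defs.v *)
From mathcomp Require Import all_boot.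
From Stdlib Require List.

Set Implicit Arguments.
Unset Strict Implicit.
Unset Printing Implicit Defensive.

Declare Scope form_scope.
Delimit Scope form_scope with form.

(** * Many-sorted classical first-order logic with equality

    All function symbols below are unary and all predicate symbols other than
    equality are binary, so signatures are restricted to these arities. *)

Record signature := Signature {
  srt : eqType;
  funsym : Type;
  fdom : funsym -> srt;
  fcod : funsym -> srt;
  predsym : Type;
  pdom1 : predsym -> srt;
  pdom2 : predsym -> srt
}.

Section Logic.

Variable L : signature.

(** Variables are de Bruijn indices, counted separately for each sort:
    [Var s i] refers to the [i]-th enclosing quantifier over the sort [s]. *)

Inductive term : srt L -> Type :=
| Var (s : srt L) (i : nat) : term s
| App (f : funsym L) (t : term (fdom f)) : term (fcod f).

Inductive form : Type :=
| Eq (s : srt L) (t u : term s)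
| Rel (p : predsym L) (t : term (pdom1 p)) (u : term (pdom2 p))
| Bot
| Imp (A B : form)
| And (A B : form)
| Or (A B : form)
| All (s : srt L) (A : form)
| Ex (s : srt L) (A : form).

Definition Not A := Imp A Bot.
Definition Iff A B := And (Imp A B) (Imp B A).

Definition renaming := srt L -> nat -> nat.

Definition up_ren (s : srt L) (r : renaming) : renaming :=
  fun s' i =>
    if s' == s then (if i is j.+1 then (r s' j).+1 else 0) else r s' i.

Fixpoint ren_term (r : renaming) s (t : term s) : term s :=
  match t with
  | Var s i => Var s (r s i)
  | App f t => App (ren_term r t)
  end.

Fixpoint ren (r : renaming) (A : form) : form :=
  match A with
  | Eq _ t u => Eq (ren_term r t) (ren_term r u)
  | Rel _ t u => Rel (ren_term r t) (ren_term r u)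
  | Bot => Bot
  | Imp A B => Imp (ren r A) (ren r B)
  | And A B => And (ren r A) (ren r B)
  | Or A B => Or (ren r A) (ren r B)
  | All s A => All s (ren (up_ren s r) A)
  | Ex s A => Ex s (ren (up_ren s r) A)
  end.

(** Weakening by one fresh variable of sort [s]. *)
Definition shift (s : srt L) : renaming :=
  fun s' i => if s' == s then i.+1 else i.

Definition substitution := forall s : srt L, nat -> term s.

Definition up_sub (s : srt L) (g : substitution) : substitution :=
  fun s' i =>
    if s' == s then
      (if i is j.+1 then ren_term (shift s) (g s' j) else Var s' 0)
    else ren_term (shift s) (g s' i).

Fixpoint sub_term (g : substitution) s (t : term s) : term s :=
  match t with
  | Var s i => g s i
  | App f t => App (sub_term g t)
  end.

Fixpoint sub (g : substitution) (A : form) : form :=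
  match A with
  | Eq _ t u => Eq (sub_term g t) (sub_term g u)
  | Rel _ t u => Rel (sub_term g t) (sub_term g u)
  | Bot => Bot
  | Imp A B => Imp (sub g A) (sub g B)
  | And A B => And (sub g A) (sub g B)
  | Or A B => Or (sub g A) (sub g B)
  | All s A => All s (sub (up_sub s g) A)
  | Ex s A => Ex s (sub (up_sub s g) A)
  end.

Definition single (s : srt L) (t : term s) : substitution :=
  fun s' i =>
    match s =P s' with
    | ReflectT e => if i is j.+1 then Var s' j else eq_rect s term t s' e
    | ReflectF _ => Var s' i
    end.

(** Substitution of [t] for the variable [Var s 0] bound by a quantifier that
    is being removed. *)
Definition inst (s : srt L) (t : term s) (A : form) : form := sub (single t) A.

(** [scoped k A]: every free variable [Var s i] of [A] satisfies [i < k s]. *)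

Fixpoint scoped_term (k : srt L -> nat) s (t : term s) : bool :=
  match t with
  | Var s i => i < k s
  | App _ t => scoped_term k t
  end.

Fixpoint scoped (k : srt L -> nat) (A : form) : bool :=
  let bind s := fun s' => if s' == s then (k s').+1 else k s' in
  match A with
  | Eq _ t u => scoped_term k t && scoped_term k u
  | Rel _ t u => scoped_term k t && scoped_term k u
  | Bot => true
  | Imp A B => scoped k A && scoped k B
  | And A B => scoped k A && scoped k B
  | Or A B => scoped k A && scoped k B
  | All s A => scoped (bind s) A
  | Ex s A => scoped (bind s) A
  end.

Definition sentence (A : form) : Prop := scoped (fun=> 0) A.

(** Classical natural deduction from the set of axioms [T].  The eigenvariable
    conditions of [nd_AllI] and [nd_ExE] concern only the hypotheses [G] and not
    [T], so an axiom with free variables has the force of its universal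
    closure. *)
Inductive nd (T : form -> Prop) : seq form -> form -> Prop :=
| nd_Ax G A : T A -> nd T G A
| nd_Hyp G A : List.In A G -> nd T G A
| nd_RAA G A : nd T (Not A :: G) Bot -> nd T G A
| nd_ImpI G A B : nd T (A :: G) B -> nd T G (Imp A B)
| nd_ImpE G A B : nd T G (Imp A B) -> nd T G A -> nd T G B
| nd_AndI G A B : nd T G A -> nd T G B -> nd T G (And A B)
| nd_AndE1 G A B : nd T G (And A B) -> nd T G A
| nd_AndE2 G A B : nd T G (And A B) -> nd T G B
| nd_OrI1 G A B : nd T G A -> nd T G (Or A B)
| nd_OrI2 G A B : nd T G B -> nd T G (Or A B)
| nd_OrE G A B C :
    nd T G (Or A B) -> nd T (A :: G) C -> nd T (B :: G) C -> nd T G C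
| nd_AllI G s A : nd T (map (ren (shift s)) G) A -> nd T G (All s A)
| nd_AllE G s A (t : term s) : nd T G (All s A) -> nd T G (inst t A)
| nd_ExI G s A (t : term s) : nd T G (inst t A) -> nd T G (Ex s A)
| nd_ExE G s A C :
    nd T G (Ex s A) ->
    nd T (A :: map (ren (shift s)) G) (ren (shift s) C) -> nd T G C
| nd_EqRefl G s (t : term s) : nd T G (Eq t t)
| nd_EqSubst G s (t u : term s) A :
    nd T G (Eq t u) -> nd T G (inst t A) -> nd T G (inst u A).

Definition provable (T : form -> Prop) (A : form) : Prop := nd T [::] A.

End Logic.

Arguments Var {L} s i.
Arguments Bot {L}.
Arguments shift {L} s _ _.

Notation "A ⇒ B" := (Imp A B) (at level 99, right associativity) : form_scope.
Notation "A ⇔ B" := (Iff A B) (at level 95, no associativity) : form_scope.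
Notation "A ∨ B" := (Or A B) (at level 85, right associativity) : form_scope.
Notation "A ∧ B" := (And A B) (at level 80, right associativity) : form_scope.
Notation "¬ A" := (Not A) (at level 75, right associativity) : form_scope.
Notation "t ≐ u" := (Eq t u) (at level 70, no associativity) : form_scope.
Notation "T ⊢ A" := (provable T A) (at level 99, no associativity).

Open Scope form_scope.

(** * One-sorted set-theoretic languages

    The primitive symbols are =, ∈ and the unary function symbols in [F]. *)

Section SetLanguage.

Variable F : Type.

Definition set_sig : signature :=
  @Signature unit F (fun=> tt) (fun=> tt) unit (fun=> tt) (fun=> tt).

Definition sterm := @term set_sig tt.
Definition sform := form set_sig.

Definition sv (i : nat) : sterm := @Var set_sig tt i.
Definition sapp (f : F) (t : sterm) : sterm := @App set_sig f t.
Definition sIn (t u : sterm) : sform := @Rel set_sig tt t u.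
Definition sAll (A : sform) : sform := @All set_sig tt A.
Definition sEx (A : sform) : sform := @Ex set_sig tt A.

Definition sren (r : nat -> nat) (A : sform) : sform :=
  @ren set_sig (fun=> r) A.
Definition slift (t : sterm) : sterm := ren_term (@shift set_sig tt) t.

(** (∀x ∈ t) A and (∃x ∈ t) A; lifting [t] ensures that x does not occur in it. *)
Definition sBall (t : sterm) (A : sform) : sform := sAll (sIn (sv 0) (slift t) ⇒ A).
Definition sBex (t : sterm) (A : sform) : sform := sEx (sIn (sv 0) (slift t) ∧ A).

Definition sSub (t u : sterm) : sform :=
  sAll (sIn (sv 0) (slift t) ⇒ sIn (sv 0) (slift u)).

Inductive Delta0 : sform -> Prop :=
| D0_Eq (t u : sterm) : Delta0 (t ≐ u)
| D0_In t u : Delta0 (sIn t u)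
| D0_Bot : Delta0 Bot
| D0_Imp A B : Delta0 A -> Delta0 B -> Delta0 (A ⇒ B)
| D0_And A B : Delta0 A -> Delta0 B -> Delta0 (A ∧ B)
| D0_Or A B : Delta0 A -> Delta0 B -> Delta0 (A ∨ B)
| D0_Ball t A : Delta0 A -> Delta0 (sBall t A)
| D0_Bex t A : Delta0 A -> Delta0 (sBex t A).

Inductive Pi1 : sform -> Prop :=
| Pi1_Delta0 A : Delta0 A -> Pi1 A
| Pi1_All A : Pi1 A -> Pi1 (sAll A).

End SetLanguage.

Arguments sv {F} i.
Arguments sIn {F} t u.
Arguments sSub {F} t u.

(** The language ∈, =, V̄ *)

Variant fun_V := fV.
Definition V_form := sform fun_V.

(** * The theory EA^set *)

Variant fun_EA := eV | eP.
Definition EA_form := sform fun_EA.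

Definition EV (t : sterm fun_EA) : sterm fun_EA := sapp eV t.
Definition EP (t : sterm fun_EA) : sterm fun_EA := sapp eP t.

(** If [A] is φ(v₀), with parameters v₁, v₂, …, the formula
    [at_var k j A] is φ(v_j) below [k] further quantifiers, where the
    parameters have become v_k, v_(k+1), …  *)
Definition at_var F (k j : nat) (A : sform F) : sform F :=
  sren (fun i => if i is i'.+1 then k + i' else j) A.

Inductive EAset : EA_form -> Prop :=
| EA_ext :
    (* x = v₀, y = v₁ *)
    EAset (sv 0 ≐ sv 1 ⇔
           sAll (sIn (sv 0) (sv 1) ⇔ sIn (sv 0) (sv 2)))
| EA_sep A : Delta0 A ->
    (* x = v₀, which may be among the parameters of φ *)
    EAset (sEx (sAll (sIn (sv 0) (sv 1) ⇔ sIn (sv 0) (sv 2) ∧ at_var 2 0 A)))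
| EA_pow :
    (* y = v₀, x = v₁ *)
    EAset (sIn (sv 0) (EP (sv 1)) ⇔ sSub (sv 0) (sv 1))
| EA_V :
    (* y = v₀, x = v₁ *)
    EAset (sIn (sv 0) (EV (sv 1)) ⇔
           sBex (sv 1) (sIn (sv 1) (EP (EV (sv 0)))))
| EA_ind A : Delta0 A ->
    (* under the three universal quantifiers, x = v₂, y = v₁, z = v₀ *)
    EAset (sEx (sAll (¬ sIn (sv 0) (sv 1)) ∧ A) ∧
           sAll (sAll (sAll
             (at_var 3 2 A ∧ at_var 3 1 A ∧
              sAll (sIn (sv 0) (sv 1) ⇔ sIn (sv 0) (sv 3) ∨ sv 0 ≐ sv 2) ⇒
              at_var 3 0 A)))
           ⇒ sAll A).

Fixpoint V_to_EA_term s (t : @term (set_sig fun_V) s) : sterm fun_EA :=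
  match t with
  | Var _ i => sv i
  | App _ t => EV (V_to_EA_term t)
  end.

(** The inclusion of the language ∈, =, V̄ into that of EA^set *)
Fixpoint V_to_EA (A : V_form) : EA_form :=
  match A with
  | Eq _ t u => V_to_EA_term t ≐ V_to_EA_term u
  | Rel _ t u => sIn (V_to_EA_term t) (V_to_EA_term u)
  | Bot => Bot
  | Imp A B => V_to_EA A ⇒ V_to_EA B
  | And A B => V_to_EA A ∧ V_to_EA B
  | Or A B => V_to_EA A ∨ V_to_EA B
  | All _ A => sAll (V_to_EA A)
  | Ex _ A => sEx (V_to_EA A)
  end.

(** * The theory H^ω *)

Variant pred_H := pIn | pEps of nat.

Definition H_sig : signature :=
  @Signature nat unit (fun=> 0) (fun=> 0) pred_H
    (fun p => if p is pEps n then n else 0)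
    (fun p => if p is pEps n then n.+1 else 0).

Definition hterm (n : nat) := @term H_sig n.
Definition H_form := form H_sig.

Definition hv (n i : nat) : hterm n := @Var H_sig n i.
Definition HV (t : hterm 0) : hterm 0 := @App H_sig tt t.
Definition hIn (t u : hterm 0) : H_form := @Rel H_sig pIn t u.
Definition hEps n (t : hterm n) (u : hterm n.+1) : H_form :=
  @Rel H_sig (pEps n) t u.
Definition hAll (n : nat) (A : H_form) : H_form := @All H_sig n A.
Definition hEx (n : nat) (A : H_form) : H_form := @Ex H_sig n A.

(** Type-0 variables *)
Definition v (i : nat) : hterm 0 := hv 0 i.
Definition lift0 (t : hterm 0) : hterm 0 := ren_term (@shift H_sig 0) t.

Definition hSub (t u : hterm 0) : H_form :=
  hAll 0 (hIn (v 0) (lift0 t) ⇒ hIn (v 0) (lift0 u)).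

(** As indices are counted separately for each type, a quantifier over one type
    leaves the indices of the variables of the other types unchanged. *)
Inductive Homega : H_form -> Prop :=
| H_ext_type n :
    Homega (hAll n (hEps (hv n 0) (hv n.+1 0) ⇔ hEps (hv n 0) (hv n.+1 1)) ⇒
            hv n.+1 0 ≐ hv n.+1 1)
| H_compr n (A : H_form) :
    (* [A] is φ(y) with y = [hv n 0] *)
    Homega (hEx n.+1 (hAll n
      (hEps (hv n 0) (hv n.+1 0) ⇔ ren (@shift H_sig n.+1) A)))
| H_ext :
    (* x = v₀, y = v₁ *)
    Homega (v 0 ≐ v 1 ⇔ hAll 0 (hIn (v 0) (v 1) ⇔ hIn (v 0) (v 2)))
| H_sep :
    (* x = v₀, Y = [hv 1 0] *)
    Homega (hEx 0 (hAll 0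
      (hIn (v 0) (v 1) ⇔ hIn (v 0) (v 2) ∧ hEps (v 0) (hv 1 0))))
| H_V :
    (* y = v₀, x = v₁ *)
    Homega (hIn (v 0) (HV (v 1)) ⇔
            hEx 0 (hIn (v 0) (v 2) ∧ hSub (v 1) (HV (v 0)))).

(** ** The class HF and relativization to it *)

Definition hTrans (t : hterm 0) : H_form :=
  hAll 0 (hIn (v 0) (lift0 t) ⇒ hSub (v 0) (lift0 t)).

Definition hOrd (t : hterm 0) : H_form :=
  hTrans t ∧ hAll 0 (hIn (v 0) (lift0 t) ⇒ hTrans (v 0)).

Definition hZero (t : hterm 0) : H_form := hAll 0 (¬ hIn (v 0) (lift0 t)).

(** u = S(t) *)
Definition hSucc (t u : hterm 0) : H_form :=
  hAll 0 (hIn (v 0) (lift0 u) ⇔ hIn (v 0) (lift0 t) ∨ v 0 ≐ lift0 t).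

Definition hNat (t : hterm 0) : H_form :=
  hOrd t ∧
  hAll 0 (hOrd (v 0) ∧ (hIn (v 0) (lift0 t) ∨ v 0 ≐ lift0 t) ⇒
          hZero (v 0) ∨ hEx 0 (hOrd (v 0) ∧ hSucc (v 0) (v 1))).

Definition hHF (t : hterm 0) : H_form :=
  hEx 0 (hNat (v 0) ∧ hIn (lift0 t) (HV (v 0))).

Fixpoint V_to_H_term s (t : @term (set_sig fun_V) s) : hterm 0 :=
  match t with
  | Var _ i => v i
  | App _ t => HV (V_to_H_term t)
  end.

Fixpoint relHF (A : V_form) : H_form :=
  match A with
  | Eq _ t u => V_to_H_term t ≐ V_to_H_term u
  | Rel _ t u => hIn (V_to_H_term t) (V_to_H_term u)
  | Bot => Bot
  | Imp A B => relHF A ⇒ relHF B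
  | And A B => relHF A ∧ relHF B
  | Or A B => relHF A ∨ relHF B
  | All _ A => hAll 0 (hHF (v 0) ⇒ relHF A)
  | Ex _ A => hEx 0 (hHF (v 0) ∧ relHF A)
  end.

(* Main.v *)
From mathcomp Require Import all_boot.
From Stdlib Require Import ClassicalEpsilon FunctionalExtensionality.
From Stdlib Require Import PropExtensionality Eqdep.
Require Import Defs.
Set Implicit Arguments.
Unset Strict Implicit.
Unset Printing Implicit Defensive.

(** Both theories are compared through their models: derivability is the same as
    truth in all models ([soundness], [completeness]), so it suffices to turn a model
    of either theory in which the sentence fails into a model of the other one in
    which it fails.  A bounded formula only sees the iterated elements of its
    parameters and of the values of V, so its truth value does not change between two
    structures that have these in common ([Delta0_transfer]), and a universal
    sentence fails as soon as one of its bounded instances does.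

    From a model of EA^set to a model of H^ω ([sat_of_H_provable]).  Let a
    counterexample lie in [V w].  The sets P(V w), P(P(V w)), ... are the types of a
    structure for H^ω.  A higher-order formula over it is a bounded formula of the
    given model, hence comprehension is an instance of bounded separation.  The
    remaining point is that the class HF of this structure contains [V w]; this
    holds because every set has a rank that is a natural number ([exists_rank]).

    From a model of H^ω to a model of EA^set ([sat_of_EA_provable]).  Here the
    natural numbers may have a largest element, and then the class HF is not closed
    under power sets.  Let a counterexample lie in [hV n] with [n] natural.  The
    higher types supply the missing sets: the subsets of [hV n], the classes of such
    subsets, the classes of those, and so on, are the levels of a cumulative
    hierarchy above [hV n].  Objects of different levels are identified when they
    have the same elements ([same]).  The hierarchy is closed under power sets, every
    bounded formula with parameters of given levels is a higher-order formula
    ([hdef_sat_raw]), which gives separation, and adduction induction holds because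
    [hV n] is finite in the sense of the model ([finite_natural]) and power sets of
    finite objects are finite ([finite_pw]).

    In both directions the function V behaves as in the theory of ranks.  This only
    uses its recursive equation and induction on membership ([rank_transitive],
    [rank_idem], [rank_compare]).  In EA^set that induction follows from adduction
    induction, in H^ω from the fact that the equation for V excludes classes without
    a minimal element ([foundation]). *)

(** * Renaming and substitution *)

(** Unlike the decision that comes with an [eqType], an instance of this class can be
    evaluated, so that the truth of a concrete formula unfolds by computation. *)
Class sort_dec (L : signature) :=
  dec : forall s s' : srt L, {s = s'} + {s <> s'}.

Section Syntax.
Variable L : signature.
Implicit Types (A B : form L) (r q : renaming L) (g : substitution L).

Lemma ren_term_comp r q s (t : term s) :
  ren_term r (ren_term q t) = ren_term (fun s i => r s (q s i)) t.
Proof. by elim: t => //= f t ->. Qed.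

Lemma up_ren_comp s r q :
  (fun s' i => up_ren s r s' (up_ren s q s' i)) =
  up_ren s (fun s' i => r s' (q s' i)).
Proof.
apply: functional_extensionality_dep => s'; apply: functional_extensionality => i.
by rewrite /up_ren; case: eqP => // _; case: i.
Qed.

Lemma ren_comp A : forall r q,
  ren r (ren q A) = ren (fun s i => r s (q s i)) A.
Proof.
elim: A => //= [s t u|p t u|A IA B IB|A IA B IB|A IA B IB|s A IA|s A IA] r q;
  by rewrite ?ren_term_comp ?IA ?IB ?up_ren_comp.
Qed.

Lemma ren_term_id s (t : term s) : ren_term (fun (s : srt L) i => i) t = t.
Proof. by elim: t => //= f t ->. Qed.

Lemma up_ren_id s : up_ren s (fun (s : srt L) i => i) = (fun s i => i).
Proof.
apply: functional_extensionality_dep => s'; apply: functional_extensionality => i.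
by rewrite /up_ren; case: eqP => // _; case: i.
Qed.

Lemma ren_id A : ren (fun s i => i) A = A.
Proof.
elim: A => //= [s t u|p t u|A IA B IB|A IA B IB|A IA B IB|s A IA|s A IA];
  by rewrite ?ren_term_id ?up_ren_id ?IA ?IB.
Qed.

Lemma sub_ren_term g r s (t : term s) :
  sub_term g (ren_term r t) = sub_term (fun s i => g s (r s i)) t.
Proof. by elim: t => //= f t ->. Qed.

Lemma up_sub_ren s g r :
  (fun s' i => up_sub s g s' (up_ren s r s' i)) =
  up_sub s (fun s' i => g s' (r s' i)).
Proof.
apply: functional_extensionality_dep => s'; apply: functional_extensionality => i.
by rewrite /up_ren /up_sub; case: eqP => // _; case: i.
Qed.

Lemma sub_ren A : forall g r, sub g (ren r A) = sub (fun s i => g s (r s i)) A.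
Proof.
elim: A => //= [s t u|p t u|A IA B IB|A IA B IB|A IA B IB|s A IA|s A IA] g r;
  by rewrite ?sub_ren_term ?IA ?IB ?up_sub_ren.
Qed.

Lemma ren_sub_term r g s (t : term s) :
  ren_term r (sub_term g t) = sub_term (fun s i => ren_term r (g s i)) t.
Proof. by elim: t => //= f t ->. Qed.

Lemma shift_up_ren s r :
  (fun s' i => up_ren s r s' (shift s s' i)) = (fun s' i => shift s s' (r s' i)).
Proof.
apply: functional_extensionality_dep => s'; apply: functional_extensionality => i.
by rewrite /up_ren /shift; case: eqP.
Qed.

Lemma ren_shift_comm s r A :
  ren (up_ren s r) (ren (shift s) A) = ren (shift s) (ren r A).
Proof. by rewrite !ren_comp shift_up_ren. Qed.

Lemma ren_up_sub s r g :
  (fun s' i => ren_term (up_ren s r) (up_sub s g s' i)) =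
  up_sub s (fun s' i => ren_term r (g s' i)).
Proof.
apply: functional_extensionality_dep => s'; apply: functional_extensionality => i.
rewrite /up_sub; case E: (s' == s) => //; last by rewrite !ren_term_comp shift_up_ren.
case: i => [|i] /=; first by rewrite /up_ren E.
by rewrite !ren_term_comp shift_up_ren.
Qed.

Lemma ren_sub A : forall r g,
  ren r (sub g A) = sub (fun s i => ren_term r (g s i)) A.
Proof.
elim: A => //= [s t u|p t u|A IA B IB|A IA B IB|A IA B IB|s A IA|s A IA] r g;
  by rewrite ?ren_sub_term ?IA ?IB ?ren_up_sub.
Qed.

Lemma sub_term_var r s (t : term s) :
  sub_term (fun s i => Var s (r s i)) t = ren_term r t.
Proof. by elim: t => //= f t ->. Qed.

Lemma up_sub_var s r :
  up_sub s (fun s i => Var s (r s i)) = (fun s' i => Var s' (up_ren s r s' i)).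
Proof.
apply: functional_extensionality_dep => s'; apply: functional_extensionality => i.
rewrite /up_ren /up_sub; case E: (s' == s) => /=; last by rewrite /shift E.
by case: i => //= i; rewrite /shift E.
Qed.

Lemma sub_var A : forall r, sub (fun s i => Var s (r s i)) A = ren r A.
Proof.
elim: A => //= [s t u|p t u|A IA B IB|A IA B IB|A IA B IB|s A IA|s A IA] r;
  by rewrite ?sub_term_var ?up_sub_var ?IA ?IB.
Qed.

Lemma ren_inst r s (t : term s) A :
  ren r (inst t A) = inst (ren_term r t) (ren (up_ren s r) A).
Proof.
rewrite /inst ren_sub sub_ren; congr (sub _ A).
apply: functional_extensionality_dep => s'; apply: functional_extensionality => i.
rewrite /single /up_ren; case: (s =P s') => [E|E].
  by case: s' / E; rewrite eqxx; case: i.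
by case: eqP => // E'; case: E.
Qed.

(** [r] after the binder of sort [s] has been instantiated by the variable [k]. *)
Definition scons_ren s (k : nat) r : renaming L :=
  fun s' i => if s' == s then (if i is j.+1 then r s' j else k) else r s' i.

Lemma inst_var s k r A :
  inst (Var s k) (ren (up_ren s r) A) = ren (scons_ren s k r) A.
Proof.
rewrite /inst sub_ren -sub_var; congr (sub _ A).
apply: functional_extensionality_dep => s'; apply: functional_extensionality => i.
rewrite /single /up_ren /scons_ren; case: (s =P s') => [E|E].
  by case: s' / E; rewrite eqxx; case: i.
by case: eqP => // E'; case: E.
Qed.

Lemma inst_var0 s k A :
  inst (Var s k) A = ren (scons_ren s k (fun _ i => i)) A.
Proof. by rewrite -inst_var up_ren_id ren_id. Qed.

Lemma single_shift (s : srt L) (t : term s) :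
  (fun s' i => single t s' (shift s s' i)) = (fun s' i => @Var L s' i).
Proof.
apply: functional_extensionality_dep => s'; apply: functional_extensionality => i.
rewrite /single /shift; case: (s =P s') => [E|E].
  by case: s' / E; rewrite eqxx.
by case: eqP => // E'; case: E.
Qed.

Lemma inst_term_shift (s : srt L) (t : term s) s' (u : term s') :
  sub_term (single t) (ren_term (shift s) u) = u.
Proof.
by rewrite sub_ren_term single_shift (sub_term_var (fun (_ : srt L) i => i)) ren_term_id.
Qed.

Lemma single0 (s : srt L) (t : term s) : single t s 0 = t.
Proof. by rewrite /single; case: (s =P s) => // E; rewrite eq_axiomK. Qed.

Lemma ren_term_scoped (k : srt L -> nat) s (t : term s) r q :
  scoped_term k t -> (forall s i, i < k s -> r s i = q s i) ->
  ren_term r t = ren_term q t.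
Proof. by elim: t => /= [s' i ki rq|f t IH kt rq]; rewrite ?rq // IH. Qed.

Lemma ren_scoped A : forall (k : srt L -> nat) r q,
  scoped k A -> (forall s i, i < k s -> r s i = q s i) -> ren r A = ren q A.
Proof.
have up s (k : srt L -> nat) r q : (forall s i, i < k s -> r s i = q s i) ->
  forall s' i, i < (if s' == s then (k s').+1 else k s') ->
    up_ren s r s' i = up_ren s q s' i.
  move=> rq s' i; rewrite /up_ren; case: eqP => _; last exact: rq.
  by case: i => // i ki; rewrite rq.
elim: A => //= [s t u|p t u|A IA B IB|A IA B IB|A IA B IB|s A IA|s A IA] k r q.
1,2: by move=> /andP[kt ku] rq; rewrite (ren_term_scoped kt rq) (ren_term_scoped ku rq).
1,2,3: by move=> /andP[kA kB] rq; rewrite (IA _ _ _ kA rq) (IB _ _ _ kB rq).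
1,2: by move=> kA /up-/(_ s) rq; rewrite (IA _ _ _ kA rq).
Qed.

(** Bound variables are counted as well; all that matters is that the free variables
    are among finitely many. *)
Fixpoint varbound_term s (t : @term L s) : nat :=
  match t with Var _ i => i.+1 | App _ t => varbound_term t end.

Fixpoint varbound A : nat :=
  match A with
  | Eq _ t u => maxn (varbound_term t) (varbound_term u)
  | Rel _ t u => maxn (varbound_term t) (varbound_term u)
  | Bot => 0
  | Imp A B | And A B | Or A B => maxn (varbound A) (varbound B)
  | All _ A | Ex _ A => varbound A
  end.

Fixpoint sorts_term s (t : @term L s) : seq (srt L) :=
  match t with Var s _ => [:: s] | App _ t => sorts_term t end.

Fixpoint sorts A : seq (srt L) :=
  match A with
  | Eq _ t u => sorts_term t ++ sorts_term u
  | Rel _ t u => sorts_term t ++ sorts_term u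
  | Bot => [::]
  | Imp A B | And A B | Or A B => sorts A ++ sorts B
  | All _ A | Ex _ A => sorts A
  end.

Lemma scoped_term_sorts s (t : term s) (k : srt L -> nat) :
  (forall s, s \in sorts_term t -> varbound_term t <= k s) -> scoped_term k t.
Proof. by elim: t => //= s' i; apply; rewrite inE. Qed.

Lemma scoped_sorts A : forall k : srt L -> nat,
  (forall s, s \in sorts A -> varbound A <= k s) -> scoped k A.
Proof.
elim: A => //= [s t u|p t u|A IA B IB|A IA B IB|A IA B IB|s A IA|s A IA] k kP.
1,2: by apply/andP; split; apply: scoped_term_sorts => s' hs';
  have := kP s'; rewrite mem_cat hs' ?orbT geq_max => /(_ isT)/andP[].
1,2,3: by apply/andP; split; (apply: IA || apply: IB) => s' hs';
  have := kP s'; rewrite mem_cat hs' ?orbT geq_max => /(_ isT)/andP[].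
1,2: by apply: IA => s' hs'; case: eqP => _; rewrite ?leqW // kP.
Qed.

Lemma scoped_varbound A : scoped (fun=> varbound A) A.
Proof. by apply: scoped_sorts. Qed.

End Syntax.

(** * Structures and soundness *)

Section Semantics.
Context (L : signature) {dL : sort_dec L}.

(** Equality is interpreted by a relation, as the models below are built from
    representatives and not from equivalence classes. *)
Record structure := Structure {
  dom : srt L -> Type;
  deq : forall s, dom s -> dom s -> Prop;
  fint : forall f : funsym L, dom (fdom f) -> dom (fcod f);
  rint : forall p : predsym L, dom (pdom1 p) -> dom (pdom2 p) -> Prop
}.

Definition congruent (M : structure) : Prop :=
  [/\ forall s (x : dom M s), deq x x,
      forall s (x y z : dom M s), deq x y -> deq x z -> deq y z,
      forall f (x y : dom M (fdom f)), deq x y -> deq (fint x) (fint y) &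
      forall p (x x' : dom M (pdom1 p)) (y y' : dom M (pdom2 p)),
        deq x x' -> deq y y' -> rint x y -> rint x' y'].

Definition strict (M : structure) : Prop :=
  forall s (x y : dom M s), deq x y <-> x = y.

Section Sat.
Variable M : structure.

Definition env := forall s : srt L, nat -> dom M s.

Definition econs s (d : dom M s) (e : env) : env := fun s' i =>
  match dec s s' with
  | left h => if i is j.+1 then e s' j else eq_rect s (dom M) d s' h
  | right _ => e s' i
  end.

Fixpoint eval (e : env) s (t : @term L s) : dom M s :=
  match t in term s return dom M s with
  | Var s i => e s i
  | App f t => fint (eval e t)
  end.

Fixpoint sat (e : env) (A : form L) : Prop :=
  match A with
  | Eq s t u => deq (eval e t) (eval e u)
  | Rel p t u => rint (eval e t) (eval e u)
  | Bot => False
  | Imp A B => sat e A -> sat e B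
  | And A B => sat e A /\ sat e B
  | Or A B => sat e A \/ sat e B
  | All s A => forall d : dom M s, sat (econs d e) A
  | Ex s A => exists d : dom M s, sat (econs d e) A
  end.

Lemma sat_Iff e A B : sat e (Iff A B) <-> (sat e A <-> sat e B).
Proof. by []. Qed.

Lemma econs0 s (d : dom M s) e : econs d e s 0 = d.
Proof. by rewrite /econs; case: (dec s s) => // h; rewrite eq_axiomK. Qed.

Lemma econsS s (d : dom M s) e i : econs d e s i.+1 = e s i.
Proof. by rewrite /econs; case: (dec s s). Qed.

Lemma econs_neq s s' (d : dom M s) e i : s <> s' -> econs d e s' i = e s' i.
Proof. by rewrite /econs; case: (dec s s'). Qed.

Lemma econs_shift s (d : dom M s) e :
  (fun s' i => econs d e s' (shift s s' i)) = e.
Proof.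
apply: functional_extensionality_dep => s'; apply: functional_extensionality => i.
rewrite /econs /shift; case: (dec s s') => [h|h]; first by case: s' / h; rewrite eqxx.
by case: eqP => // h'; case: h.
Qed.

Lemma econs_up_ren s (d : dom M s) e r :
  (fun s' i => econs d e s' (up_ren s r s' i)) =
  econs d (fun s' i => e s' (r s' i)).
Proof.
apply: functional_extensionality_dep => s'; apply: functional_extensionality => i.
rewrite /econs /up_ren; case: (dec s s') => h.
  by case: s' / h; rewrite eqxx; case: i.
by case: eqP => // h'; case: h.
Qed.

Lemma econs_comm s s' (d : dom M s) (d' : dom M s') e :
  s <> s' -> econs d (econs d' e) = econs d' (econs d e).
Proof.
move=> ss'; apply: functional_extensionality_dep => x.
apply: functional_extensionality => i; rewrite /econs.
case: (dec s x) => h; case: (dec s' x) => h' //.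
by case: ss'; rewrite h h'.
Qed.

Lemma eval_ren e r s (t : term s) :
  eval e (ren_term r t) = eval (fun s i => e s (r s i)) t.
Proof. by elim: t => //= f t ->. Qed.

Lemma sat_ren A : forall e r,
  sat e (ren r A) <-> sat (fun s i => e s (r s i)) A.
Proof.
elim: A => //= [s t u|p t u|A IA B IB|A IA B IB|A IA B IB|s A IA|s A IA] e r;
  rewrite ?eval_ren ?IA ?IB //.
  by split=> h d; move: (h d); rewrite IA econs_up_ren.
by split=> -[d h]; exists d; move: h; rewrite IA econs_up_ren.
Qed.

Lemma sat_shift s (d : dom M s) e A : sat (econs d e) (ren (shift s) A) <-> sat e A.
Proof. by rewrite sat_ren econs_shift. Qed.

Lemma eval_sub e g s (t : term s) :
  eval e (sub_term g t) = eval (fun s i => eval e (g s i)) t.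
Proof. by elim: t => //= f t ->. Qed.

Lemma econs_up_sub s (d : dom M s) e g :
  (fun s' i => eval (econs d e) (up_sub s g s' i)) =
  econs d (fun s' i => eval e (g s' i)).
Proof.
apply: functional_extensionality_dep => s'; apply: functional_extensionality => i.
rewrite /up_sub; case: eqP => h; last first.
  by rewrite eval_ren econs_shift econs_neq // => h'; case: h.
case: s / h d => d; case: i => [|i] /=; first by rewrite !econs0.
by rewrite eval_ren econs_shift econsS.
Qed.

Lemma sat_sub A : forall e g,
  sat e (sub g A) <-> sat (fun s i => eval e (g s i)) A.
Proof.
elim: A => //= [s t u|p t u|A IA B IB|A IA B IB|A IA B IB|s A IA|s A IA] e g;
  rewrite ?eval_sub ?IA ?IB //.
  by split=> h d; move: (h d); rewrite IA econs_up_sub.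
by split=> -[d h]; exists d; move: h; rewrite IA econs_up_sub.
Qed.

Lemma sat_inst e s (t : term s) A : sat e (inst t A) <-> sat (econs (eval e t) e) A.
Proof.
rewrite /inst sat_sub; have -> // :
  (fun s' i => eval e (single t s' i)) = econs (eval e t) e.
apply: functional_extensionality_dep => s'; apply: functional_extensionality => i.
rewrite /single; case: eqP => h; last by rewrite econs_neq.
by case: s' / h; case: i => [|i]; rewrite ?econs0 ?econsS.
Qed.

Definition deq_env (e e' : env) := forall s i, deq (e s i) (e' s i).

Hypothesis congM : congruent M.

Lemma deq_refl s (x : dom M s) : deq x x.
Proof. by case: congM. Qed.

Lemma deq_sym s (x y : dom M s) : deq x y -> deq y x.
Proof. by case: congM => r t _ _ xy; apply: t xy (r _ _). Qed.

Lemma deq_trans s (x y z : dom M s) : deq x y -> deq y z -> deq x z.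
Proof. by case: congM => r t _ _ /deq_sym; apply: t. Qed.

Lemma deq_eval e e' s (t : term s) : deq_env e e' -> deq (eval e t) (eval e' t).
Proof. by move=> ee'; elim: t => //= f t; case: congM => _ _ + _; apply. Qed.

Lemma deq_econs s (d d' : dom M s) e e' :
  deq d d' -> deq_env e e' -> deq_env (econs d e) (econs d' e').
Proof.
move=> dd' ee' s' i; rewrite /econs; case: (dec s s') => h //.
by case: s' / h; case: i.
Qed.

Lemma sat_deq_imp A : forall e e', deq_env e e' -> sat e A -> sat e' A.
Proof.
have sym e e' : deq_env e e' -> deq_env e' e by move=> h s i; apply/deq_sym/h.
elim: A => //= [s t u|p t u|A IA B IB|A IA B IB|A IA B IB|s A IA|s A IA] e e' ee'.
- move=> tu; apply: deq_trans (deq_eval u ee').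
  by apply: deq_trans tu; apply/deq_sym/deq_eval.
- by case: congM => _ _ _; apply; apply: deq_eval.
- by move=> AB /(IA _ _ (sym _ _ ee'))/AB; apply: IB.
- by case=> /(IA _ _ ee') hA /(IB _ _ ee') hB.
- by case=> [/(IA _ _ ee')|/(IB _ _ ee')]; [left|right].
- by move=> h d; apply: IA (h d); apply: deq_econs => //; apply: deq_refl.
- by case=> d h; exists d; apply: IA h; apply: deq_econs => //; apply: deq_refl.
Qed.

Lemma sat_deq A e e' : deq_env e e' -> (sat e A <-> sat e' A).
Proof.
by move=> ee'; split; apply: sat_deq_imp => // s i; apply/deq_sym/ee'.
Qed.

End Sat.

Definition models (M : structure) (T : form L -> Prop) : Prop :=
  forall A, T A -> forall e : env M, sat e A.

Theorem soundness M T G A : congruent M -> models M T -> nd T G A ->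
  forall e : env M, (forall B, List.In B G -> sat e B) -> sat e A.
Proof.
move=> cM MT; elim=> {G A} /=.
- by move=> G A TA e _; apply: MT.
- by move=> G A inG e; apply.
- move=> G A _ IH e eG; apply: NNPP => nA; apply: (IH e) => B [<-|/eG] //.
- by move=> G A B _ IH e eG hA; apply: IH => C [<-|/eG].
- by move=> G A B _ IAB _ IA e eG; apply: (IAB e eG); apply: IA.
- by move=> G A B _ IA _ IB e eG; split; [apply: IA|apply: IB].
- by move=> G A B _ IH e /IH [].
- by move=> G A B _ IH e /IH [].
- by move=> G A B _ IH e /IH; left.
- by move=> G A B _ IH e /IH; right.
- move=> G A B C _ IAB _ IA _ IB e eG.
  by case: (IAB e eG) => h; [apply: IA|apply: IB] => D [<-|/eG].
- move=> G s A _ IH e eG d; apply: IH => B /List.in_map_iff [C [<- inC]].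
  by rewrite sat_shift; apply: eG.
- by move=> G s A t _ IH e eG; rewrite sat_inst; apply: (IH e eG).
- by move=> G s A t _ IH e eG; have := IH e eG; rewrite sat_inst; exists (eval e t).
- move=> G s A C _ IEx _ IC e eG; case: (IEx e eG) => d hd.
  rewrite -(sat_shift d); apply: IC => B [<- //|/List.in_map_iff [D [<- inD]]].
  by rewrite sat_shift; apply: eG.
- by move=> G s t e _; apply: deq_refl.
- move=> G s t u A _ Itu _ IA e eG; have := IA e eG; rewrite !sat_inst.
  apply: sat_deq_imp => //; apply: deq_econs; first exact: Itu.
  by move=> s' i; apply: deq_refl.
Qed.

End Semantics.

(** * Renaming of derivations *)

Section Derivations.
Variables (L : signature) (T : form L -> Prop).
Implicit Types (A B C : form L) (G : seq (form L)) (r : renaming L).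

Lemma nd_weaken G A : nd T G A ->
  forall G', (forall B, List.In B G -> List.In B G') -> nd T G' A.
Proof.
have cons_sub G' G'' B : (forall C, List.In C G' -> List.In C G'') ->
  forall C, List.In C (B :: G') -> List.In C (B :: G'').
  by move=> h C /= [->|/h]; [left|right].
have map_sub G' G'' f : (forall C, List.In C G' -> List.In C G'') ->
  forall C, List.In C (map (ren f) G') -> List.In C (map (ren f) G'').
  by move=> h C /List.in_map_iff [D [<- /h D']]; apply/List.in_map_iff; exists D.
elim=> {G A}.
- by move=> *; apply: nd_Ax.
- by move=> G A inG G' GG'; apply/nd_Hyp/GG'.
- by move=> G A _ IH G' GG'; apply/nd_RAA/IH/cons_sub.
- by move=> G A B _ IH G' GG'; apply/nd_ImpI/IH/cons_sub.
- by move=> G A B _ IA _ IB G' GG'; apply: nd_ImpE (IA _ GG') (IB _ GG').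
- by move=> G A B _ IA _ IB G' GG'; apply: nd_AndI (IA _ GG') (IB _ GG').
- by move=> G A B _ IH G' GG'; apply: nd_AndE1 (IH _ GG').
- by move=> G A B _ IH G' GG'; apply: nd_AndE2 (IH _ GG').
- by move=> G A B _ IH G' GG'; apply: nd_OrI1 (IH _ GG').
- by move=> G A B _ IH G' GG'; apply: nd_OrI2 (IH _ GG').
- move=> G A B C _ IH _ IA _ IB G' GG'.
  by apply: nd_OrE (IH _ GG') (IA _ (cons_sub _ _ _ GG')) (IB _ (cons_sub _ _ _ GG')).
- by move=> G s A _ IH G' GG'; apply/nd_AllI/IH/map_sub.
- by move=> G s A t _ IH G' GG'; apply: nd_AllE (IH _ GG').
- by move=> G s A t _ IH G' GG'; apply: nd_ExI (IH _ GG').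
- move=> G s A C _ IE _ IC G' GG'; apply: nd_ExE (IE _ GG') (IC _ _).
  exact/cons_sub/map_sub.
- by move=> *; apply: nd_EqRefl.
- by move=> G s t u A _ IE _ IA G' GG'; apply: nd_EqSubst (IE _ GG') (IA _ GG').
Qed.

Lemma nd_iter_All s n A : nd T [::] A -> nd T [::] (iter n (All s) A).
Proof. by move=> TA; elim: n => //= n IH; apply: nd_AllI. Qed.

(** The quantifiers are eliminated one after the other, from the outside; the variables
    that are free under all of them move down by [n]. *)
Lemma nd_iter_AllE (s : srt L) n : forall (r : nat -> nat) A,
  nd T [::] (iter n (All s) A) ->
  nd T [::] (ren (fun s' i => if s' == s then (if i < n then r i else i - n) else i) A).
Proof.
elim: n => [|n IH] r A /=.
  rewrite [X in ren X _](_ : _ = (fun _ i => i)) ?ren_id //.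
  apply: functional_extensionality_dep => s'; apply: functional_extensionality => i.
  by rewrite subn0; case: eqP.
rewrite -iterS iterSr => /(IH (fun i => r i.+1)) /= h.
have := nd_AllE (Var s (r 0)) h; rewrite inst_var.
rewrite [X in ren X _](_ : _ = (fun s' i => if s' == s then
  if i < n.+1 then r i else i - n.+1 else i)) //.
apply: functional_extensionality_dep => s'; apply: functional_extensionality => i.
by rewrite /scons_ren; case: eqP => //; case: i.
Qed.

Lemma nd_ren_sort (s : srt L) (r : nat -> nat) A :
  nd T [::] A -> nd T [::] (ren (fun s' i => if s' == s then r i else i) A).
Proof.
move=> /(nd_iter_All s (varbound A)) /(nd_iter_AllE r) h.
rewrite (ren_scoped (q := fun s' i => if s' == s then
  (if i < varbound A then r i else i - varbound A) else i) (scoped_varbound A)) //.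
by move=> s' i ->.
Qed.

(** Only finitely many sorts occur in [A], and renamings of the variables of
    different sorts do not interfere, so the sorts can be treated in turn. *)
Lemma nd_ren_closed r A : nd T [::] A -> nd T [::] (ren r A).
Proof.
move=> TA.
suff h (l : seq (srt L)) : nd T [::] (ren (fun s i => if s \in l then r s i else i) A).
  rewrite (ren_scoped (k := fun s => if s \in sorts A then varbound A else 0)
    (q := fun s i => if s \in sorts A then r s i else i)) //.
    by apply: scoped_sorts => s ->.
  by move=> s i; case: (s \in sorts A).
elim: l => [|x l IH]; first by rewrite ren_id.
case: (boolP (x \in l)) => xl.
  rewrite [X in ren X _](_ : _ = (fun s i => if s \in l then r s i else i)) //.
  apply: functional_extensionality_dep => s; apply: functional_extensionality => i.
  by rewrite inE; case: eqP => // ->; rewrite xl.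
have := nd_ren_sort x (r x) IH; rewrite ren_comp.
rewrite [X in ren X _](_ : _ = (fun s i => if s \in x :: l then r s i else i)) //.
apply: functional_extensionality_dep => s; apply: functional_extensionality => i.
by rewrite inE; case: eqP => // ->; rewrite (negbTE xl).
Qed.

Lemma nd_ren G A : nd T G A -> forall r, nd T (map (ren r) G) (ren r A).
Proof.
have shift_map r s G' : map (ren (up_ren s r)) (map (ren (shift s)) G') =
    map (ren (shift s)) (map (ren r) G').
  by rewrite -!map_comp; apply: eq_map => B /=; rewrite ren_shift_comm.
elim=> {G A} /=.
- move=> G A TA r; apply: (nd_weaken (G := [::])) => //.
  exact/nd_ren_closed/nd_Ax.
- by move=> G A inG r; apply/nd_Hyp/List.in_map.
- by move=> G A _ IH r; apply/nd_RAA/IH.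
- by move=> G A B _ IH r; apply/nd_ImpI/IH.
- by move=> G A B _ IA _ IB r; apply: nd_ImpE (IA r) (IB r).
- by move=> G A B _ IA _ IB r; apply: nd_AndI.
- by move=> G A B _ IH r; apply: nd_AndE1 (IH r).
- by move=> G A B _ IH r; apply: nd_AndE2 (IH r).
- by move=> G A B _ IH r; apply: nd_OrI1 (IH r).
- by move=> G A B _ IH r; apply: nd_OrI2 (IH r).
- by move=> G A B C _ IH _ IA _ IB r; apply: nd_OrE (IH r) (IA r) (IB r).
- by move=> G s A _ IH r; apply: nd_AllI; rewrite -shift_map.
- by move=> G s A t _ IH r; rewrite ren_inst; apply: nd_AllE (IH r).
- move=> G s A t _ IH r; apply: (nd_ExI (t := ren_term r t)).
  by rewrite -ren_inst; apply: IH.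
- move=> G s A C _ IE _ IC r; apply: nd_ExE (IE r) _.
  by have := IC (up_ren s r); rewrite shift_map ren_shift_comm.
- by move=> *; apply: nd_EqRefl.
- move=> G s t u A _ IE _ IA r; have := IA r; rewrite !ren_inst.
  exact/nd_EqSubst/IE.
Qed.

Lemma nd_hyp0 G A : nd T (A :: G) A.
Proof. by apply: nd_Hyp; left. Qed.

Lemma nd_hyp1 G A B : nd T (B :: A :: G) A.
Proof. by apply: nd_Hyp; right; left. Qed.

Lemma nd_absurd G A : nd T G Bot -> nd T G A.
Proof.
by move=> h; apply: nd_RAA; apply: (nd_weaken h) => B; right.
Qed.

Lemma nd_eq_sym s (t u : @term L s) : nd T [:: Eq t u] (Eq u t).
Proof.
have := @nd_EqSubst L T [:: Eq t u] s t u (Eq (Var s 0) (ren_term (shift s) t)).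
by rewrite /inst /= !single0 !inst_term_shift; apply; [apply: nd_hyp0|apply: nd_EqRefl].
Qed.

Lemma nd_eq_trans s (t u w : @term L s) : nd T [:: Eq t u; Eq u w] (Eq t w).
Proof.
have := @nd_EqSubst L T [:: Eq t u; Eq u w] s u w (Eq (ren_term (shift s) t) (Var s 0)).
by rewrite /inst /= !single0 !inst_term_shift; apply; [apply: nd_hyp1|apply: nd_hyp0].
Qed.

Lemma nd_eq_app (f : funsym L) (t u : term (fdom f)) :
  nd T [:: Eq t u] (Eq (App t) (App u)).
Proof.
have := @nd_EqSubst L T [:: Eq t u] _ t u
  (Eq (ren_term (shift (fdom f)) (App t)) (App (Var (fdom f) 0))).
by rewrite /inst /= !single0 !inst_term_shift; apply; [apply: nd_hyp0|apply: nd_EqRefl].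
Qed.

Lemma nd_eq_rel (p : predsym L) (t t' : term (pdom1 p)) (u u' : term (pdom2 p)) :
  nd T [:: Eq t t'; Eq u u'; Rel t u] (Rel t' u').
Proof.
set G := [:: _; _; _].
have h : nd T G (Rel t' u).
  have := @nd_EqSubst L T G _ t t' (Rel (Var (pdom1 p) 0) (ren_term (shift (pdom1 p)) u)).
  rewrite /inst /= !single0 !inst_term_shift; apply; first exact: nd_hyp0.
  by apply: nd_Hyp; right; right; left.
have := @nd_EqSubst L T G _ u u' (Rel (ren_term (shift (pdom2 p)) t') (Var (pdom2 p) 0)).
by rewrite /inst /= !single0 !inst_term_shift; apply=> //; apply: nd_hyp1.
Qed.

Lemma nd_not_all s A : nd T [:: Not (All s A)] (Ex s (Not A)).
Proof.
apply: nd_RAA; apply: nd_ImpE (nd_hyp1 _ _ _) _; apply: nd_AllI => /=.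
apply: nd_RAA; apply: nd_ImpE (nd_hyp1 _ _ _) _.
apply: (nd_ExI (t := Var s 0)); rewrite /inst /= -/(inst _ _) inst_var.
rewrite (_ : scons_ren s 0 (shift s) = (fun _ i => i)) ?ren_id; first exact: nd_hyp0.
apply: functional_extensionality_dep => s'; apply: functional_extensionality => i.
by rewrite /scons_ren /shift; case: eqP => //; case: i.
Qed.

(** A variable that is fresh for the context can take the place of the
    eigenvariable of an existential quantifier. *)
Lemma nd_fresh s x A G : varbound A <= x ->
  (forall B, List.In B G -> varbound B <= x) ->
  nd T (inst (Var s x) A :: G) Bot -> nd T (A :: map (ren (shift s)) G) Bot.
Proof.
move=> Ax Gx.
(* The renaming that undoes the instantiation by [x] and is a shift elsewhere. *)
pose r : renaming L := fun s' i => if s' == s then (if i == x then 0 else i.+1) else i.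
move=> /nd_ren/(_ r) /=; rewrite inst_var0 ren_comp.
have -> : ren (fun s' i => r s' (scons_ren s x (fun _ i => i) s' i)) A = A.
  rewrite -[RHS]ren_id; apply: ren_scoped (scoped_varbound A) _ => s' i.
  rewrite /r /scons_ren; case: eqP => // _; case: i => [|i] iA; first by rewrite eqxx.
  by rewrite ltn_eqF // (leq_trans _ Ax) // ltnW.
have -> // : map (ren r) G = map (ren (shift s)) G.
elim: G Gx => //= B G IH Gx; rewrite IH; last by move=> C CG; apply: Gx; right.
congr cons; apply: ren_scoped (scoped_varbound B) _ => s' i iB.
rewrite /r /shift; case: eqP => // _.
by rewrite ltn_eqF // (leq_trans iB) //; apply: Gx; left.
Qed.

End Derivations.

(** * Strict models from congruent ones *)

Section Quotient.
Context (L : signature) {dL : sort_dec L} (M : structure L) (congM : congruent M).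

Definition class s := {P : dom M s -> Prop | exists x, P = deq x}.

Definition pi s (x : dom M s) : class s := exist _ (deq x) (ex_intro _ x erefl).

Definition repr s (c : class s) : dom M s :=
  proj1_sig (constructive_indefinite_description _ (proj2_sig c)).

Lemma pi_eq s (x y : dom M s) : pi x = pi y <-> deq x y.
Proof.
split=> [[] h|xy].
  by have := deq_refl congM y; rewrite -h => /(deq_sym congM); apply: deq_sym.
have e : deq x = deq y.
  apply: functional_extensionality => z; apply: propositional_extensionality.
  by split; apply: (deq_trans congM) => //; apply: (deq_sym congM).
by apply: eq_sig_hprop => //= P; apply: proof_irrelevance.
Qed.

Lemma reprK s (c : class s) : pi (repr c) = c.
Proof.
rewrite /repr; case: constructive_indefinite_description => x /= h.
by apply: eq_sig_hprop => //= P; apply: proof_irrelevance.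
Qed.

Lemma repr_pi s (x : dom M s) : deq (repr (pi x)) x.
Proof. by apply/pi_eq; rewrite reprK. Qed.

Definition quotient : structure L :=
  @Structure L class (fun s => eq)
    (fun f c => pi (fint (repr c))) (fun p c c' => rint (repr c) (repr c')).

Lemma repr_eval (e : env quotient) s (t : term s) :
  deq (repr (eval e t)) (eval (fun s i => repr (e s i)) t).
Proof.
elim: t => [s' i|f t IH] /=; first exact: deq_refl.
apply: deq_trans (repr_pi _) _ => //.
by case: (congM) => _ _ + _; apply.
Qed.

Lemma repr_econs s (d : dom quotient s) (e : env quotient) :
  (fun s' i => repr (econs d e s' i)) = econs (repr d) (fun s i => repr (e s i)).
Proof.
apply: functional_extensionality_dep => s'; apply: functional_extensionality => i.
rewrite /econs; case: (dec s s') => h //.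
by case: s' / h; case: i.
Qed.

Lemma sat_quotient A : forall e : env quotient,
  sat e A <-> sat (fun s i => repr (e s i)) A.
Proof.
have sym s x y := @deq_sym L M congM s x y.
elim: A => //= [s t u|p t u|A IA B IB|A IA B IB|A IA B IB|s A IA|s A IA] e;
  rewrite ?IA ?IB //.
- rewrite -[eval e t]reprK -[eval e u]reprK pi_eq; split=> h.
    apply: (deq_trans congM _ (repr_eval e u)).
    by apply: (deq_trans congM _ h); apply/sym/repr_eval.
  apply: (deq_trans congM (repr_eval e t)).
  by apply: (deq_trans congM h); apply/sym/repr_eval.
- case: (congM) => _ _ _ h; split; apply: h; first [exact: repr_eval | exact/sym/repr_eval].
- split=> h d; last by have := h (repr d); rewrite IA repr_econs.
  have := h (pi d); rewrite IA repr_econs; apply: sat_deq_imp => //.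
  by apply: deq_econs => //; [apply: repr_pi|move=> s' i; apply: deq_refl].
split=> -[d h]; first by exists (repr d); move: h; rewrite IA repr_econs.
exists (pi d); rewrite IA repr_econs; apply: sat_deq_imp h => //.
apply: deq_econs => //; first exact/sym/repr_pi.
by move=> s' i; apply: deq_refl.
Qed.

End Quotient.

(** * The Henkin construction *)

Section Completeness.
Context (L : signature) {dL : sort_dec L} (T : form L -> Prop).
Variables (enum : nat -> form L) (enumP : forall A, exists n, enum n = A).
Implicit Types (A B C : form L) (G : seq (form L)).

Definition consistent G : Prop := ~ nd T G Bot.

Definition fresh G : nat := \max_(B <- G) varbound B.

Lemma freshP G B : List.In B G -> varbound B <= fresh G.
Proof.
rewrite /fresh; elim: G => //= C G IH; rewrite big_cons => -[->|/IH h].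
  exact: leq_maxl.
by apply: leq_trans h (leq_maxr _ _).
Qed.

(** A fresh variable serves as the Henkin constant of an existential formula: as the
    contexts are finite and axioms count as universally closed, there always is one. *)
Definition witness A G : seq (form L) :=
  if A is Ex s B then inst (Var s (fresh (A :: G))) B :: A :: G else A :: G.

Definition extend A G : seq (form L) :=
  if excluded_middle_informative (consistent (A :: G)) then witness A G else G.

Lemma consistent_witness A G : consistent (A :: G) -> consistent (witness A G).
Proof.
case: A => // s B cBG /nd_fresh h; apply: cBG.
apply: nd_ExE (nd_hyp0 _ _ _) _; apply: h; last exact: freshP.
exact: (@freshP (Ex s B :: G) (Ex s B) (or_introl erefl)).
Qed.

Lemma consistent_extend A G : consistent G -> consistent (extend A G).
Proof.
by rewrite /extend; case: excluded_middle_informative => [cA _|] //; apply: consistent_witness.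
Qed.

Lemma extend_sub A G B : List.In B G -> List.In B (extend A G).
Proof.
rewrite /extend => BG; case: excluded_middle_informative => [_|//] /=.
by case: A => *; do ?right.
Qed.

Variables (G0 : seq (form L)) (consG0 : consistent G0).

Fixpoint chain n : seq (form L) := if n is m.+1 then extend (enum m) (chain m) else G0.

Lemma consistent_chain n : consistent (chain n).
Proof. by elim: n => //= n; apply: consistent_extend. Qed.

Lemma chain_sub m n B : m <= n -> List.In B (chain m) -> List.In B (chain n).
Proof.
move=> /subnK <-; elim: (n - m) => [|k IH] //; rewrite addSn /= => /IH.
exact: extend_sub.
Qed.

Definition Henkin A : Prop := exists n, nd T (chain n) A.

Lemma Henkin_ImpE A B : Henkin (Imp A B) -> Henkin A -> Henkin B.
Proof.
move=> [m hm] [n hn]; exists (maxn m n).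
by apply: nd_ImpE (nd_weaken hm _) (nd_weaken hn _) => C;
  apply: chain_sub; rewrite ?leq_maxl ?leq_maxr.
Qed.

Lemma Henkin_nd G A : (forall B, List.In B G -> Henkin B) -> nd T G A -> Henkin A.
Proof.
elim: G A => [|B G IH] A GH; first by move=> h; exists 0; apply: (nd_weaken h).
move=> /nd_ImpI/IH h; apply: Henkin_ImpE (h _) (GH _ _); last by left.
by move=> C CG; apply: GH; right.
Qed.

Lemma Henkin0 A : nd T [::] A -> Henkin A.
Proof. exact: Henkin_nd. Qed.

Lemma Henkin1 A B : nd T [:: A] B -> Henkin A -> Henkin B.
Proof. by move=> AB hA; apply: Henkin_nd AB => C [<-|[]]. Qed.

Lemma Henkin2 A B C : nd T [:: A; B] C -> Henkin A -> Henkin B -> Henkin C.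
Proof. by move=> AB hA hB; apply: Henkin_nd AB => D [<-|[<-|[]]]. Qed.

Lemma Henkin_consistent : ~ Henkin Bot.
Proof. by case=> n; apply: consistent_chain. Qed.

Lemma Henkin_total A : Henkin A \/ Henkin (Not A).
Proof.
case: (enumP A) => n nA; case: (classic (consistent (A :: chain n))) => cA.
  left; exists n.+1; rewrite /= nA /extend.
  case: excluded_middle_informative => [_|//] /=.
  apply: nd_Hyp; rewrite /witness; case: A {nA cA} => *; try by left.
  by right; left.
by right; exists n; apply: nd_ImpI; apply: NNPP.
Qed.

Lemma Henkin_Not A : Henkin (Not A) <-> ~ Henkin A.
Proof.
split=> [nA /(Henkin_ImpE nA)|]; first exact: Henkin_consistent.
by case: (Henkin_total A).
Qed.

Lemma Henkin_Ex s A : Henkin (Ex s A) <-> exists x, Henkin (inst (Var s x) A).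
Proof.
split=> [hA|[x]]; last by apply: Henkin1; apply: nd_ExI (nd_hyp0 _ _ _).
case: (enumP (Ex s A)) => n nA.
exists (fresh (Ex s A :: chain n)), n.+1; rewrite /= nA /extend.
case: excluded_middle_informative => [_|cA] /=; first exact: nd_hyp0.
case: Henkin_consistent; apply: Henkin_ImpE hA; exists n; apply: nd_ImpI.
exact: NNPP.
Qed.

Lemma Henkin_Imp A B : Henkin (Imp A B) <-> (Henkin A -> Henkin B).
Proof.
split=> [|AB]; first exact: Henkin_ImpE.
case: (Henkin_total A) => [/AB|]; apply: Henkin1; apply: nd_ImpI; first exact: nd_hyp1.
exact/nd_absurd/nd_ImpE/nd_hyp0/nd_hyp1.
Qed.

Lemma Henkin_And A B : Henkin (And A B) <-> Henkin A /\ Henkin B.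
Proof.
split=> [h|[hA hB]].
  split; move: h; apply: Henkin1.
    exact/nd_AndE1/nd_hyp0.
  exact/nd_AndE2/nd_hyp0.
by apply: Henkin2 hA hB; apply: nd_AndI; [apply: nd_hyp0|apply: nd_hyp1].
Qed.

Lemma Henkin_Or A B : Henkin (Or A B) <-> Henkin A \/ Henkin B.
Proof.
split=> [h|[]]; last first.
- by apply: Henkin1; apply/nd_OrI2/nd_hyp0.
- by apply: Henkin1; apply/nd_OrI1/nd_hyp0.
apply: NNPP => /not_or_and [/Henkin_Not nA /Henkin_Not nB].
apply: Henkin_consistent.
apply: (Henkin_nd (G := [:: Or A B; Not A; Not B])).
  by move=> C [<-|[<-|[<-|[]]]].
apply: nd_OrE (nd_hyp0 _ _ _) _ _.
  by apply: nd_ImpE (nd_hyp0 _ _ _); apply: nd_Hyp; do 2 right; left.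
by apply: nd_ImpE (nd_hyp0 _ _ _); apply: nd_Hyp; do 3 right; left.
Qed.

Lemma Henkin_All s A : Henkin (All s A) <-> forall x, Henkin (inst (Var s x) A).
Proof.
split=> [h x|h]; first by move: h; apply/Henkin1/nd_AllE/nd_hyp0.
case: (Henkin_total (All s A)) => // /(Henkin1 (nd_not_all _ _ _)) /Henkin_Ex [x].
by move=> /Henkin_Not nx; case: (nx (h x)).
Qed.

(** In the term model a variable denotes itself, so that environments are
    renamings; existential witnesses make the variables represent all terms. *)
Definition term_model : structure L :=
  @Structure L (fun=> nat)
    (fun s i j => Henkin (Eq (Var s i) (Var s j)))
    (fun f i => epsilon (inhabits 0)
       (fun j => Henkin (Eq (Var _ j) (App (Var (fdom f) i)))))
    (fun p i j => Henkin (Rel (Var (pdom1 p) i) (Var (pdom2 p) j))).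

Lemma Henkin_sym s (t u : @term L s) : Henkin (Eq t u) -> Henkin (Eq u t).
Proof. exact/Henkin1/nd_eq_sym. Qed.

Lemma Henkin_trans s (t u w : @term L s) :
  Henkin (Eq t u) -> Henkin (Eq u w) -> Henkin (Eq t w).
Proof. exact/Henkin2/nd_eq_trans. Qed.

Lemma Henkin_rel (p : predsym L) (t t' : term (pdom1 p)) (u u' : term (pdom2 p)) :
  Henkin (Eq t t') -> Henkin (Eq u u') -> Henkin (Rel t u) -> Henkin (Rel t' u').
Proof.
move=> tt' uu' tu.
by apply: Henkin_nd (nd_eq_rel T t t' u u') => C [<-|[<-|[<-|[]]]].
Qed.

Lemma inst_eq_shift s (t u : @term L s) :
  inst t (Eq (Var s 0) (ren_term (shift s) u)) = Eq t u.
Proof. by rewrite /inst /= single0 inst_term_shift. Qed.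

Lemma fint_term_model (f : funsym L) (i : nat) :
  Henkin (Eq (Var _ (@fint L term_model f i)) (App (Var (fdom f) i))).
Proof.
apply: (epsilon_spec (inhabits 0)
  (fun j => Henkin (Eq (Var (fcod f) j) (App (Var (fdom f) i))))).
have : Henkin (Ex (fcod f) (Eq (Var (fcod f) 0)
    (ren_term (shift (fcod f)) (App (Var (fdom f) i))))).
  apply: Henkin0; apply: (nd_ExI (t := App (Var (fdom f) i))).
  by rewrite inst_eq_shift; apply: nd_EqRefl.
by move=> /Henkin_Ex [x]; rewrite inst_eq_shift; exists x.
Qed.

Lemma term_model_congruent : congruent term_model.
Proof.
split=> /= [s i|s i j k ij ik|f i j ij|p i i' j j'].
- exact/Henkin0/nd_EqRefl.
- by apply: Henkin_trans ik; apply: Henkin_sym.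
- apply: Henkin_trans (fint_term_model _ _) _.
  apply: Henkin_trans (Henkin_sym (fint_term_model _ _)).
  by move: ij; apply/Henkin1/nd_eq_app.
exact: Henkin_rel.
Qed.

Lemma eval_term_model (e : env term_model) s (t : @term L s) :
  Henkin (Eq (Var s (eval e t)) (ren_term e t)).
Proof.
elim: t => [s' i|f t IH] /=; first exact/Henkin0/nd_EqRefl.
apply: Henkin_trans (fint_term_model _ _) _.
by move: IH; apply/Henkin1/nd_eq_app.
Qed.

Lemma econs_term_model s (d : nat) (e : env term_model) :
  @econs _ _ term_model s d e = scons_ren s d e.
Proof.
apply: functional_extensionality_dep => s'; apply: functional_extensionality => i.
rewrite /econs /scons_ren; case: (dec s s') => h.
  by case: s' / h; rewrite eqxx; case: i.
by case: eqP => // h'; case: h.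
Qed.

Lemma sat_term_model A : forall e : env term_model, sat e A <-> Henkin (ren e A).
Proof.
elim: A => //= [s t u|p t u||A IA B IB|A IA B IB|A IA B IB|s A IA|s A IA] e.
- have ht := eval_term_model e t; have hu := eval_term_model e u; split=> h.
    by apply: Henkin_trans hu; apply: Henkin_trans h; apply: Henkin_sym.
  by apply: Henkin_trans (Henkin_sym hu); apply: Henkin_trans h.
- have ht := eval_term_model e t; have hu := eval_term_model e u; split.
    exact: Henkin_rel.
  by apply: Henkin_rel; apply: Henkin_sym.
- by split=> // /Henkin_consistent.
- by rewrite Henkin_Imp IA IB.
- by rewrite Henkin_And IA IB.
- by rewrite Henkin_Or IA IB.
- rewrite Henkin_All; split=> h d; have := h d;
  by rewrite inst_var IA econs_term_model.
- rewrite Henkin_Ex; split=> -[d h]; exists d; move: h;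
  by rewrite inst_var IA econs_term_model.
Qed.

Lemma term_model_models : models term_model T.
Proof. by move=> A TA e; apply/sat_term_model/Henkin0/nd_ren_closed/nd_Ax. Qed.

Lemma consistent_has_model :
  exists (M : structure L) (e : env M),
    [/\ strict M, models M T & forall B, List.In B G0 -> sat e B].
Proof.
have cM := term_model_congruent.
exists (quotient term_model), (fun s i => pi (i : dom term_model s)); split=> //.
  by move=> A TA e; apply/sat_quotient/term_model_models.
move=> B BG; apply/sat_quotient; first exact: cM.
apply: (@sat_deq_imp _ _ term_model cM B (fun s i => (i : dom term_model s))).
  by move=> s i; apply/deq_sym/repr_pi.
by apply/sat_term_model; rewrite ren_id; exists 0; apply: nd_Hyp.
Qed.

End Completeness.

Theorem completeness (L : signature) (dL : sort_dec L) (enum : nat -> form L)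
    (enumP : forall A, exists n, enum n = A) (T : form L -> Prop) (A : form L) :
  (forall M : structure L, strict M -> models M T -> forall e : env M, sat e A) ->
  provable T A.
Proof.
move=> h; apply: nd_RAA; apply: NNPP => cA.
have [M [e [sM MT /(_ (Not A))]]] := consistent_has_model enumP cA.
by apply; [left|apply: h].
Qed.

(** * Countability of the formulas *)

Section Countable.
Variables (L : signature) (cs : srt L -> nat) (cf : funsym L -> nat) (cp : predsym L -> nat).
Hypotheses (cs_inj : injective cs) (cf_inj : injective cf) (cp_inj : injective cp).
Notation tree := (GenTree.tree nat).

Fixpoint code_term s (t : @term L s) : tree :=
  match t with
  | Var s i => GenTree.Node 0 [:: GenTree.Leaf (cs s); GenTree.Leaf i]
  | App f t => GenTree.Node 1 [:: GenTree.Leaf (cf f); code_term t]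
  end.

Fixpoint code (A : form L) : tree :=
  match A with
  | Eq _ t u => GenTree.Node 0 [:: code_term t; code_term u]
  | Rel p t u => GenTree.Node 1 [:: GenTree.Leaf (cp p); code_term t; code_term u]
  | Bot => GenTree.Node 2 [::]
  | Imp A B => GenTree.Node 3 [:: code A; code B]
  | And A B => GenTree.Node 4 [:: code A; code B]
  | Or A B => GenTree.Node 5 [:: code A; code B]
  | All s A => GenTree.Node 6 [:: GenTree.Leaf (cs s); code A]
  | Ex s A => GenTree.Node 7 [:: GenTree.Leaf (cs s); code A]
  end.

Lemma code_term_inj s (t : @term L s) s' (t' : @term L s') :
  code_term t = code_term t' -> existT (@term L) s t = existT (@term L) s' t'.
Proof.
elim: s / t s' t' => [s i|f t IH] s' t'; case: s' / t' => [s' j|f' t'] //= [].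
  by move=> /cs_inj -> ->.
move=> /cf_inj ff'; case: f' / ff' t' => t' /IH tt'.
by rewrite (EqdepTheory.inj_pair2 _ _ _ _ _ tt').
Qed.

Lemma code_inj : injective code.
Proof.
elim=> [s t u|p t u||A IA B IB|A IA B IB|A IA B IB|s A IA|s A IA]
  [s' t' u'|p' t' u'||A' B'|A' B'|A' B'|s' A'|s' A'] //= [].
- move=> /code_term_inj tt' /code_term_inj.
  have ss' := eq_sigT_fst tt'; case: s' / ss' t' u' tt' => t' u'.
  move=> tt' uu'.
  by rewrite (EqdepTheory.inj_pair2 _ _ _ _ _ tt') (EqdepTheory.inj_pair2 _ _ _ _ _ uu').
- move=> /cp_inj pp'; case: p' / pp' t' u' => t' u'.
  move=> /code_term_inj tt' /code_term_inj uu'.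
  by rewrite (EqdepTheory.inj_pair2 _ _ _ _ _ tt') (EqdepTheory.inj_pair2 _ _ _ _ _ uu').
- by move=> /IA -> /IB ->.
- by move=> /IA -> /IB ->.
- by move=> /IA -> /IB ->.
- by move=> /cs_inj -> /IA ->.
- by move=> /cs_inj -> /IA ->.
Qed.

Lemma form_enum : exists enum : nat -> form L, forall A, exists n, enum n = A.
Proof.
exists (fun n => epsilon (inhabits Bot) (fun A => pickle (code A) = n)) => A.
exists (pickle (code A)); apply: code_inj; apply: (pcan_inj (@pickleK _)).
exact: (epsilon_spec (inhabits Bot) (fun B => pickle (code B) = _) (ex_intro _ A erefl)).
Qed.

End Countable.

#[global] Instance set_sort_dec F : sort_dec (set_sig F) :=
  fun s s' => match s, s' with tt, tt => left erefl end.

#[global] Instance H_sort_dec : sort_dec H_sig := PeanoNat.Nat.eq_dec.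

Theorem set_completeness (F : Type) (cF : F -> nat) (T : sform F -> Prop) A :
  injective cF ->
  (forall M : structure (set_sig F), strict M -> models M T -> forall e : env M, sat e A) ->
  provable T A.
Proof.
move=> cF_inj.
have [|//||enum enumP] := @form_enum (set_sig F) (fun=> 0) cF (fun=> 0); try by move=> [] [].
exact: completeness enumP _ _.
Qed.

Theorem H_completeness (T : H_form -> Prop) A :
  (forall M : structure H_sig, strict M -> models M T -> forall e : env M, sat e A) ->
  provable T A.
Proof.
have [//|||enum enumP] := @form_enum H_sig id (fun=> 0)
  (fun p => if p is pEps n then n.+1 else 0).
- by move=> [] [].
- by move=> [|n] [|m] //= [->].
exact: completeness enumP _ _.
Qed.

Lemma econs_succ (N : structure H_sig) n (d : dom N n) (e : env N) i :
  econs d e n.+1 i = e n.+1 i.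
Proof. exact: econs_neq (@n_Sn n). Qed.

Lemma econs_succ_comm (N : structure H_sig) n (d : dom N n) (d' : dom N n.+1) (e : env N) :
  econs d (econs d' e) = econs d' (econs d e).
Proof. exact: econs_comm (@n_Sn n). Qed.

(** * Definable classes *)

Section Definability.
Context (L : signature) {dL : sort_dec L} (M : structure L).
Variable pt : forall s, dom M s.

(** A relation on an arbitrary type [X] is definable with respect to a family of
    functions on [X], the variables, when it is the truth value of a formula under
    environments all of whose components are variables or constant.  Constants are
    the parameters of the formula.  Quantification leads from [X] to [X * dom M s],
    with the second projection as a new variable, so that definability can be proved
    by following the shape of a relation, without writing down a formula. *)
Definition family X := forall s, (X -> dom M s) -> Prop.

Definition no_var X : family X := fun _ _ => False.

Definition cons_var X s (F : family X) : family (X * dom M s) := fun s' f =>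
  (exists2 g, F s' g & f = fun p => g p.1) \/
  (exists h : s = s', f = fun p => eq_rect s (dom M) p.2 s' h).

Definition var_or_par X (F : family X) s (f : X -> dom M s) :=
  (exists c, f = fun=> c) \/ F s f.

Definition good_env X (F : family X) (e : X -> env M) :=
  forall s i, var_or_par F (fun x => e x s i).

Definition term_fun X (F : family X) s (f : X -> dom M s) : Prop :=
  exists (t : term s) e, good_env F e /\ forall x, f x = eval (e x) t.

Definition definable (K : form L -> Prop) X (F : family X) (R : X -> Prop) : Prop :=
  exists A e, [/\ K A, good_env F e & forall x, R x <-> sat (e x) A].

Lemma term_fun_cst X (F : family X) s (c : dom M s) : term_fun F (fun=> c).
Proof.
exists (Var s 0), (fun _ => econs c (fun s _ => pt s)); split=> [s' i|x].
  by left; eexists.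
by rewrite /= econs0.
Qed.

Lemma term_fun_cons X (F : family X) s s' (f : X * dom M s -> dom M s') :
  (forall x d d', f (x, d) = f (x, d')) ->
  term_fun F (fun x => f (x, pt s)) -> term_fun (cons_var F) f.
Proof.
move=> fP [t [e [eF ft]]]; exists t, (fun p => e p.1); split=> [s'' i|[x d]].
  case: (eF s'' i) => [[c ec]|h].
    left; exists c; apply: functional_extensionality => -[x d] /=.
    exact: (congr1 (fun h => h x) ec).
  by right; left; exists (fun x => e x s'' i).
by rewrite -ft; apply: fP.
Qed.

Lemma term_fun_last X (F : family X) s : term_fun (cons_var (s := s) F) (fun p => p.2).
Proof.
exists (Var s 0), (fun p => econs p.2 (fun s _ => pt s)); split=> [s' i|[x d]] /=.
  rewrite /econs; case: (dec s s') => h; last by left; eexists.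
  case: i => [|i]; last by left; eexists.
  by right; right; exists h.
by rewrite econs0.
Qed.

Lemma term_fun_app X (F : family X) (h : funsym L) (f : X -> dom M (fdom h)) :
  term_fun F f -> term_fun F (fun x => fint (f x)).
Proof.
by move=> [t [e [eF ft]]]; exists (App t), e; split=> //= x; rewrite ft.
Qed.

(** Two environments are carried by one, on its even and odd variables. *)
Definition merge (e e' : env M) : env M :=
  fun s i => if odd i then e' s i./2 else e s i./2.

Lemma merge_good X (F : family X) e e' :
  good_env F e -> good_env F e' -> good_env F (fun x => merge (e x) (e' x)).
Proof. by move=> h h' s i; rewrite /merge; case: (odd i); [apply: h'|apply: h]. Qed.

Lemma merge_even e e' : (fun s i => merge e e' s i.*2) = e.
Proof.
apply: functional_extensionality_dep => s; apply: functional_extensionality => i.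
by rewrite /merge odd_double doubleK.
Qed.

Lemma merge_odd e e' : (fun s i => merge e e' s i.*2.+1) = e'.
Proof.
apply: functional_extensionality_dep => s; apply: functional_extensionality => i.
by rewrite /merge /= odd_double /= uphalf_double.
Qed.

(** A quantifier binds the variable of index 0, while the components of [e] may equal
    the last variable at any indices; the renaming [r] mediates. *)
Lemma good_env_cons X (F : family X) s (e : X * dom M s -> env M) :
  good_env (cons_var F) e ->
  exists r e', good_env F e' /\
    forall x d, e (x, d) = (fun s' i => econs d (e' x) s' (r s' i)).
Proof.
move=> eF.
have /= h s' i : exists kg : nat * (X -> dom M s'), var_or_par F kg.2 /\
    forall x d (e0 : env M), e0 s' i = kg.2 x -> e (x, d) s' i = econs d e0 s' kg.1.
  (* The index under which the variable [i] of sort [s'] appears below the quantifier. *)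
  pose k := if @dec L dL s s' then i.+1 else i.
  have kP (d : dom M s) (e0 : env M) : econs d e0 s' k = e0 s' i.
    by rewrite /econs /k; case: (dec s s') => /=.
  case: (eF s' i) => [[c ec]|[[g Fg eg]|[h eh]]].
  - exists (k, fun=> c); split=> [|x d e0 /= e0c]; first by left; exists c.
    by rewrite kP e0c (congr1 (fun h => h (x, d)) ec).
  - exists (k, g); split=> [|x d e0 /= e0c]; first by right.
    by rewrite kP e0c (congr1 (fun h => h (x, d)) eg).
  exists (0, fun=> pt s'); split=> [|x d e0 /= _]; first by left; exists (pt s').
  rewrite (congr1 (fun h => h (x, d)) eh) /=.
  by case: s' / h {i eh k kP}; rewrite econs0.
pose kg s' i := proj1_sig (constructive_indefinite_description _ (h s' i)).
have kgP s' i := proj2_sig (constructive_indefinite_description _ (h s' i)).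
exists (fun s' i => (kg s' i).1), (fun x s' i => (kg s' i).2 x); split=> [s' i|x d].
  by have [] := kgP s' i.
apply: functional_extensionality_dep => s'; apply: functional_extensionality => i.
by have [_] := kgP s' i; apply.
Qed.

Record formula_class (K : form L -> Prop) : Prop := {
  class_ren : forall r A, K A -> K (ren r A);
  class_Eq : forall s (t u : term s), K (Eq t u);
  class_Rel : forall p (t : term (pdom1 p)) (u : term (pdom2 p)), K (Rel t u);
  class_Bot : K Bot;
  class_Imp : forall A B, K A -> K B -> K (Imp A B);
  class_And : forall A B, K A -> K B -> K (And A B);
  class_Or : forall A B, K A -> K B -> K (Or A B)
}.

Variables (K : form L -> Prop) (classK : formula_class K).

(** A class that is defined with parameters only is definable in every context. *)
Lemma definable_last X (F : family X) s (R : dom M s -> Prop) :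
  definable K (cons_var (s := s) (@no_var unit)) (fun p => R p.2) ->
  definable K (cons_var (s := s) F) (fun p => R p.2).
Proof.
move=> [A [e1 [KA /good_env_cons [r [e' [eF' ee']]] h]]].
exists (ren r A), (fun p => econs p.2 (e' tt)); split=> [|s' i|p].
- exact: (class_ren classK _ KA).
- rewrite /econs; case: (dec s s') => ss'; last by left; eexists.
  by case: i => [|i]; [right; right; exists ss'|left; eexists].
by rewrite (h (tt, p.2)) ee' sat_ren.
Qed.

Section Connectives.
Variables (X : Type) (F : family X).
Implicit Types (R : X -> Prop).

Lemma definable_ext R R' : (forall x, R x <-> R' x) ->
  definable K F R -> definable K F R'.
Proof. by move=> RR' [A [e [KA eF h]]]; exists A, e; split=> // x; rewrite -RR'. Qed.

Lemma definable_merge R R' (op : form L -> form L -> form L) (op' : Prop -> Prop -> Prop) :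
  (forall A B, K A -> K B -> K (op A B)) ->
  (forall (e : env M) A B, sat e (op A B) <-> op' (sat e A) (sat e B)) ->
  definable K F R -> definable K F R' -> definable K F (fun x => op' (R x) (R' x)).
Proof.
move=> Kop opP [A [e [KA eF h]]] [A' [e' [KA' eF' h']]].
exists (op (ren (fun s i => i.*2) A) (ren (fun s i => i.*2.+1) A')).
exists (fun x => merge (e x) (e' x)); split.
- by apply: Kop; apply: class_ren.
- exact: merge_good.
move=> x; rewrite opP.
have E : R x = sat (merge (e x) (e' x)) (ren (fun s i => i.*2) A).
  by apply: propositional_extensionality; rewrite h sat_ren merge_even.
have E' : R' x = sat (merge (e x) (e' x)) (ren (fun s i => i.*2.+1) A').
  by apply: propositional_extensionality; rewrite h' sat_ren merge_odd.
by rewrite E E'.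
Qed.

Lemma definable_imp R R' :
  definable K F R -> definable K F R' -> definable K F (fun x => R x -> R' x).
Proof. by apply: (definable_merge (op' := fun P Q => P -> Q)) (class_Imp classK) _. Qed.

Lemma definable_and R R' :
  definable K F R -> definable K F R' -> definable K F (fun x => R x /\ R' x).
Proof. by apply: (definable_merge (op' := and)) (class_And classK) _. Qed.

Lemma definable_or R R' :
  definable K F R -> definable K F R' -> definable K F (fun x => R x \/ R' x).
Proof. by apply: (definable_merge (op' := or)) (class_Or classK) _. Qed.

Lemma definable_cst (P : Prop) : definable K F (fun=> P).
Proof.
have eF : good_env F (fun (_ : X) s _ => pt s) by move=> s i; left; exists (pt s).
case: (classic P) => p.
  exists (Imp Bot Bot), (fun _ s _ => pt s); split=> //=.
  by apply: (class_Imp classK); apply: (class_Bot classK).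
by exists (@Bot L), (fun _ s _ => pt s); split=> //; apply: (class_Bot classK).
Qed.

Lemma definable_not R : definable K F R -> definable K F (fun x => ~ R x).
Proof. by move=> h; apply: definable_imp h (definable_cst False). Qed.

Lemma term_fun_merge s s' (f : X -> dom M s) (g : X -> dom M s') :
  term_fun F f -> term_fun F g ->
  exists (t : term s) (u : term s') e,
    [/\ good_env F e, forall x, f x = eval (e x) t & forall x, g x = eval (e x) u].
Proof.
move=> [t [e [eF ft]]] [u [e' [eF' gu]]].
exists (ren_term (fun s i => i.*2) t), (ren_term (fun s i => i.*2.+1) u).
exists (fun x => merge (e x) (e' x)); split=> [|x|x]; first exact: merge_good.
  by rewrite eval_ren merge_even.
by rewrite eval_ren merge_odd.
Qed.

Lemma definable_Eq s (f g : X -> dom M s) :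
  term_fun F f -> term_fun F g -> definable K F (fun x => deq (f x) (g x)).
Proof.
move=> /term_fun_merge h /h [t [u [e [eF ft gu]]]].
by exists (Eq t u), e; split=> [||x] //=; [apply: (class_Eq classK)|rewrite ft gu].
Qed.

Lemma definable_Rel p (f : X -> dom M (pdom1 p)) (g : X -> dom M (pdom2 p)) :
  term_fun F f -> term_fun F g -> definable K F (fun x => rint (f x) (g x)).
Proof.
move=> /term_fun_merge h /h [t [u [e [eF ft gu]]]].
by exists (Rel t u), e; split=> [||x] //=; [apply: (class_Rel classK)|rewrite ft gu].
Qed.

End Connectives.

(** The formula classes in question differ in the quantifiers they allow. *)
Lemma definable_all (K_All : forall s A, K A -> K (All s A)) X (F : family X) s
    (R : X -> dom M s -> Prop) :
  definable K (cons_var F) (fun p => R p.1 p.2) ->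
  definable K F (fun x => forall d, R x d).
Proof.
move=> [A [e [KA /good_env_cons [r [e' [eF' ee']]] h]]].
exists (All s (ren r A)), e'; split=> //; first exact: K_All (class_ren classK _ KA).
move=> x; have /= hx d := h (x, d).
by split=> h' d; [move/hx: (h' d)|apply/hx; move: (h' d)]; rewrite /= sat_ren ee'.
Qed.

Lemma definable_ex (K_Ex : forall s A, K A -> K (Ex s A)) X (F : family X) s
    (R : X -> dom M s -> Prop) :
  definable K (cons_var F) (fun p => R p.1 p.2) ->
  definable K F (fun x => exists d, R x d).
Proof.
move=> [A [e [KA /good_env_cons [r [e' [eF' ee']]] h]]].
exists (Ex s (ren r A)), e'; split=> //; first exact: K_Ex (class_ren classK _ KA).
move=> x; have /= hx d := h (x, d).
by split=> -[d h']; exists d; [move/hx: h'|apply/hx; move: h'];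
  rewrite /= sat_ren ee'.
Qed.

End Definability.

(** * Truth of bounded formulas across structures *)

(** Both environments are carried by a single one, of which renamings recover them;
    and a renaming does not change a sentence. *)
Lemma sat_sentence (L : signature) (dL : sort_dec L) (M : structure L) A (e e' : env M) :
  sentence A -> sat e A <-> sat e' A.
Proof.
move=> cA; have fixed r : ren r A = A.
  by rewrite -[RHS]ren_id; apply: ren_scoped cA _.
rewrite -[X in sat X A <-> _](merge_even e e') -[X in _ <-> sat X A](merge_odd e e').
by rewrite -(sat_ren A _ (fun s i => i.*2)) -(sat_ren A _ (fun s i => i.*2.+1)) !fixed.
Qed.

Lemma scoped_V_to_H_term s (t : @term (set_sig fun_V) s) (k : unit -> nat) (k' : nat -> nat) :
  @scoped_term (set_sig fun_V) k s t -> k' 0 = k tt -> @scoped_term H_sig k' 0 (V_to_H_term t).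
Proof. by elim: t => //= -[] i ik ->. Qed.

Lemma scoped_relHF (A : V_form) : forall (k : unit -> nat) (k' : nat -> nat),
  @scoped (set_sig fun_V) k A -> k' 0 = k tt -> @scoped H_sig k' (relHF A).
Proof.
elim: A => /= [s t u|p t u||A IA B IB|A IA B IB|A IA B IB|s A IA|s A IA] k k' //.
1,2: by move=> /andP[kt ku] kk'; rewrite !(scoped_V_to_H_term _ kk').
1,2,3: by move=> /andP[kA kB] kk'; rewrite (IA _ _ kA kk') (IB _ _ kB kk').
all: by move=> kA kk'; apply: IA kA _; rewrite /= kk'; case: s.
Qed.

Lemma sentence_relHF (A : V_form) : sentence A -> sentence (relHF A).
Proof. by move=> cA; apply: scoped_relHF cA _. Qed.

Section Delta0Class.
Variable F : Type.

Lemma Delta0_ren (A : sform F) : Delta0 A -> forall r, Delta0 (ren r A).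
Proof.
have lift_up (t : sterm F) r : ren_term (@up_ren (set_sig F) tt r) (slift t) = slift (ren_term r t).
  by rewrite /slift !ren_term_comp shift_up_ren.
elim=> {A} [t u|t u||A B _ IA _ IB|A B _ IA _ IB|A B _ IA _ IB|t A _ IA|t A _ IA] r;
  try by constructor.
- have := D0_Ball (ren_term r t) (IA (@up_ren (set_sig F) tt r)).
  by rewrite /sBall -lift_up.
- have := D0_Bex (ren_term r t) (IA (@up_ren (set_sig F) tt r)).
  by rewrite /sBex -lift_up.
Qed.

Lemma Delta0_class : formula_class (@Delta0 F).
Proof.
split; try by constructor.
- by move=> r A /Delta0_ren.
- by move=> [] t u; constructor.
- by move=> [] t u; constructor.
Qed.

Lemma sat_at_var (M : structure (set_sig F)) (E : env M) k j (A : sform F) :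
  sat E (at_var k j A) <->
  sat (@econs _ _ M tt (E tt j) (fun s i => E s (k + i))) A.
Proof.
rewrite /at_var /sren sat_ren.
rewrite [X in sat X A <-> _](_ : _ = @econs _ _ M tt (E tt j) (fun s i => E s (k + i))) //.
by apply: functional_extensionality_dep => -[]; apply: functional_extensionality => -[|i].
Qed.

End Delta0Class.

Definition EA_reduct (M : structure (set_sig fun_EA)) : structure (set_sig fun_V) :=
  @Structure (set_sig fun_V) (dom M) (@deq _ M) (fun _ => @fint _ M eV) (@rint _ M).

Definition H_reduct (N : structure H_sig) : structure (set_sig fun_V) :=
  @Structure (set_sig fun_V) (fun=> dom N 0) (fun _ => @deq _ N 0)
    (fun _ => @fint _ N tt) (fun _ => @rint _ N pIn).

Lemma eval_V_to_EA (M : structure (set_sig fun_EA)) (e : env M) s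
    (t : @term (set_sig fun_V) s) :
  eval e (V_to_EA_term t) =
  match s as s return dom M s -> dom M tt with tt => id end (@eval _ (EA_reduct M) e s t).
Proof. by elim: t => [[] i|f t] //= ->. Qed.

Lemma sat_V_to_EA (M : structure (set_sig fun_EA)) (A : V_form) : forall e : env M,
  sat e (V_to_EA A) <-> @sat _ _ (EA_reduct M) e A.
Proof.
elim: A => /= [[] t u|[] t u||A IA B IB|A IA B IB|A IA B IB|[] A IA|[] A IA] e;
  rewrite ?IA ?IB ?eval_V_to_EA //.
- by split=> h d; have := h d; rewrite IA.
- by split=> -[d h]; exists d; move: h; rewrite IA.
Qed.

Lemma eval_V_to_H (N : structure H_sig) (e : env N) s (t : @term (set_sig fun_V) s) :
  eval e (V_to_H_term t) = @eval _ (H_reduct N) (fun=> e 0) s t.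
Proof. by elim: t => //= f t ->. Qed.

Section Transfer.
Variables (N : structure H_sig) (S : structure (set_sig fun_V)).
(** [sim] relates sets of the class HF of [N], or subsets of it, to their counterparts
    in [S]. *)
Variable sim : dom N 0 -> dom S tt -> Prop.

Definition in_HF (x : dom N 0) : Prop := forall e : env N, e 0 0 = x -> sat e (hHF (v 0)).

Hypotheses (sim_V : forall x y, sim x y -> sim (@fint _ N tt x) (@fint _ S fV y))
  (sim_eq : forall x y x' y', sim x y -> sim x' y' -> (deq x x' <-> deq y y'))
  (sim_mem : forall x y x' y', sim x y -> sim x' y' ->
     (@rint _ N pIn x x' <-> @rint _ S tt y y'))
  (sim_forth : forall x y x', sim x y -> @rint _ N pIn x' x ->
     exists2 y', sim x' y' & @rint _ S tt y' y)
  (sim_back : forall x y y', sim x y -> @rint _ S tt y' y ->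
     exists x', [/\ in_HF x', sim x' y' & @rint _ N pIn x' x]).

Definition sim_env (e : env N) (e' : env S) : Prop := forall i, sim (e 0 i) (e' tt i).

Lemma sim_eval e e' (t : @term (set_sig fun_V) tt) :
  sim_env e e' -> sim (eval e (V_to_H_term t)) (eval e' t).
Proof.
move=> ee'; suff : forall s (t : @term (set_sig fun_V) s), sim (eval e (V_to_H_term t))
  (match s as s return dom S s -> dom S tt with tt => id end (eval e' t)).
  by move/(_ tt t).
move=> {t} s t; elim: t => [[] i|[] t] /=; first exact: ee'.
exact: sim_V.
Qed.

Lemma sim_econs e e' (x : dom N 0) (y : dom S tt) :
  sim_env e e' -> sim x y -> sim_env (econs x e) (@econs _ _ S tt y e').
Proof. by move=> ee' xy [|i]; [apply: xy|apply: ee']. Qed.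

Lemma eval_slift_H (e : env N) (x : dom N 0) (t : @term (set_sig fun_V) tt) :
  eval (econs x e) (V_to_H_term (slift t)) = eval e (V_to_H_term t).
Proof.
rewrite !eval_V_to_H /slift eval_ren.
by apply: (congr1 (fun E => @eval _ (H_reduct N) E tt t)); apply: functional_extensionality_dep => -[].
Qed.

Lemma eval_slift_S (e : env S) (y : dom S tt) (t : @term (set_sig fun_V) tt) :
  eval (@econs _ _ S tt y e) (slift t) = eval e t.
Proof. by rewrite /slift eval_ren econs_shift. Qed.

(** The relativization to HF has no effect on a bounded quantifier, as the elements of
    its bound are in HF. *)
Lemma Delta0_transfer A : @Delta0 fun_V A -> forall e e', sim_env e e' ->
  sat e (relHF A) <-> sat e' A.
Proof.
elim=> {A} [t u|t u||A B _ IA _ IB|A B _ IA _ IB|A B _ IA _ IB|t A _ IA|t A _ IA] e e' ee'.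
- by apply: sim_eq; apply: sim_eval.
- by apply: sim_mem; apply: sim_eval.
- by [].
- by rewrite /= (IA _ _ ee') (IB _ _ ee').
- by rewrite /= (IA _ _ ee') (IB _ _ ee').
- by rewrite /= (IA _ _ ee') (IB _ _ ee').
- have ett' := sim_eval t ee'; split=> h.
    move=> y; rewrite /= eval_slift_S => yt.
    have [x' [xHF xy xt]] := @sim_back _ _ y ett' yt.
    apply/(IA _ _ (sim_econs ee' xy)); apply: h; first exact: xHF.
    by rewrite /= eval_slift_H.
  move=> x _; rewrite /= eval_slift_H => xt.
  have [y xy yt] := @sim_forth _ _ x ett' xt.
  by apply/(IA _ _ (sim_econs ee' xy)); apply: h; rewrite /= eval_slift_S.
have ett' := sim_eval t ee'; split=> [[x [_ []]]|[y []]].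
  rewrite /= eval_slift_H => xt; have [y xy yt] := @sim_forth _ _ x ett' xt.
  move/(IA _ _ (sim_econs ee' xy)) => h; exists y; split=> //.
  by rewrite /= eval_slift_S.
rewrite /= eval_slift_S => yt; have [x [xHF xy xt]] := @sim_back _ _ y ett' yt.
move/(IA _ _ (sim_econs ee' xy)) => h; exists x; split; first exact: xHF.
by split=> //=; rewrite eval_slift_H.
Qed.

End Transfer.

(** * Ranks *)

Section Ranks.
Variables (D : Type) (mem : D -> D -> Prop) (V : D -> D).

Definition incl x y := forall z, mem z x -> mem z y.
Definition transitive_set x := forall y, mem y x -> incl y x.

Lemma incl_trans y x z : incl x y -> incl y z -> incl x z.
Proof. by move=> xy yz w /xy/yz. Qed.

Definition in_induction (R : D -> Prop) :=
  (forall x, (forall y, mem y x -> R y) -> R x) -> forall x, R x.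

Hypothesis V_spec : forall x y, mem y (V x) <-> exists2 z, mem z x & incl y (V z).

Lemma rank_mono x y : incl x y -> incl (V x) (V y).
Proof. by move=> xy w /V_spec [z /xy zy wz]; apply/V_spec; exists z. Qed.

Lemma rank_mem z x y : mem z x -> incl y (V z) -> mem y (V x).
Proof. by move=> zx yz; apply/V_spec; exists z. Qed.

Lemma rank_incl : in_induction (fun x => incl x (V x)) -> forall x, incl x (V x).
Proof. by apply=> x IH y yx; apply: rank_mem (IH y yx). Qed.

Lemma rank_transitive :
  in_induction (fun x => transitive_set (V x)) -> forall x, transitive_set (V x).
Proof.
apply=> x IH y /V_spec [z zx yz] u uy; apply: (rank_mem zx).
exact: (IH z zx _ (yz _ uy)).
Qed.

Lemma rank_idem :
  in_induction (fun x => incl (V (V x)) (V x)) -> forall x, incl (V (V x)) (V x).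
Proof.
apply=> x IH y /V_spec [u /V_spec [z zx uz] yu]; apply: (rank_mem zx).
by apply: incl_trans yu _; apply: incl_trans (IH z zx); apply: rank_mono.
Qed.

(** The sets [V x] are linearly ordered: if [w] witnesses that [V y] is not included
    in [V x], and [w] is included in [V b] for some [b] in [y], then [V b] is included
    in no [V x'] with [x'] in [x], so that by induction [V x] is included in [V b]. *)
Lemma rank_compare (T : D -> Prop) :
  (forall x x', T x -> mem x' x -> T x') ->
  in_induction (fun y => forall x, T x -> mem (V x) (V y) \/ incl (V y) (V x)) ->
  forall y x, T x -> mem (V x) (V y) \/ incl (V y) (V x).
Proof.
move=> T_closed; apply=> y IH x Tx.
case: (classic (incl (V y) (V x))) => [|nyx]; first by right.
have [w hw] := not_all_ex_not _ _ nyx; have [/V_spec [b yb wb] wx] := imply_to_and _ _ hw.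
left; apply: (rank_mem yb) => a /V_spec [x' x'x ax'].
case: (IH b yb x' (T_closed _ _ Tx x'x)) => [/V_spec [d db x'd]|bx'].
  by apply: (rank_mem db); apply: incl_trans x'd.
by case: wx; apply: (rank_mem x'x); apply: incl_trans bx'.
Qed.

End Ranks.

(** * Models of EA^set *)

Section EAModel.
Variables (M : structure (set_sig fun_EA)) (strictM : strict M) (EA_M : models M EAset).
Notation D := (dom M tt).
Variable o : D.

Definition mem (x y : D) : Prop := @rint _ M tt x y.
Definition V (x : D) : D := @fint _ M eV x.
Definition P (x : D) : D := @fint _ M eP x.
Notation sub := (incl mem).
Notation trans := (transitive_set mem).

Definition pt : forall s, dom M s := fun s => match s with tt => o end.
Definition defn X (F : family M X) (R : X -> Prop) : Prop := definable (@Delta0 fun_EA) F R.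
Definition defn1 (R : D -> Prop) : Prop :=
  defn (@cons_var _ M _ tt (@no_var _ M unit)) (fun p => R p.2).
Definition tfun X (F : family M X) (f : X -> D) : Prop := @term_fun _ M X F tt f.
Notation extend := (@cons_var _ M _ tt).

Lemma tfun_V X (F : family M X) (f : X -> D) :
  tfun F f -> tfun F (fun x => V (f x)).
Proof. exact: (@term_fun_app _ M X F eV). Qed.

Lemma tfun_P X (F : family M X) (f : X -> D) :
  tfun F f -> tfun F (fun x => P (f x)).
Proof. exact: (@term_fun_app _ M X F eP). Qed.

Lemma tfun_last X (F : family M X) : tfun (extend F) (fun p => p.2).
Proof. exact: (term_fun_last pt). Qed.

Lemma tfun_cst X (F : family M X) (c : D) : tfun F (fun=> c).
Proof. exact: (term_fun_cst pt). Qed.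

Lemma tfun_cons X (F : family M X) (f : X * D -> D) :
  (forall x d d', f (x, d) = f (x, d')) ->
  tfun F (fun x => f (x, o)) -> tfun (extend F) f.
Proof. exact: (term_fun_cons (pt := pt)). Qed.

Lemma defn_mem X (F : family M X) (f g : X -> D) :
  tfun F f -> tfun F g -> defn F (fun x => mem (f x) (g x)).
Proof. exact: (@definable_Rel _ _ M _ (@Delta0_class _) X F tt). Qed.

Lemma defn_eq X (F : family M X) (f g : X -> D) :
  tfun F f -> tfun F g -> defn F (fun x => f x = g x).
Proof.
move=> hf hg; apply: definable_ext (definable_Eq (Delta0_class _) hf hg).
by move=> x; apply: strictM.
Qed.

Lemma sat_sBall (e : env M) (t : sterm fun_EA) (A : EA_form) :
  sat e (sBall t A) <-> forall d : D, mem d (eval e t) -> sat (@econs _ _ M tt d e) A.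
Proof.
rewrite /sBall /sAll /=.
by split=> h d; have := h d; rewrite /= /slift eval_ren econs_shift.
Qed.

(** The bound of a quantifier may contain function symbols, so the formula has to be
    combined with the term of the bound. *)
Lemma defn_ball X (F : family M X) (t : X -> D) (R : X -> D -> Prop) :
  tfun F t -> defn (extend F) (fun p => R p.1 p.2) ->
  defn F (fun x => forall d, mem d (t x) -> R x d).
Proof.
move=> [t0 [e [eF te]]] [A [e1 [KA /(good_env_cons pt) [r [e' [eF' ee']]] h]]].
exists (sBall (ren_term (fun s i => i.*2) t0)
  (ren (@up_ren (set_sig fun_EA) tt (fun s i => i.*2.+1)) (ren r A))).
exists (fun x => merge (e x) (e' x)); split.
- by apply: D0_Ball; do 2 apply: Delta0_ren.
- exact: merge_good.
move=> x; have hx d : R x d <-> sat (e1 (x, d)) A by exact: (h (x, d)).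
rewrite sat_sBall eval_ren merge_even -te.
by split=> h' d /h'; rewrite hx ee' sat_ren econs_up_ren merge_odd sat_ren.
Qed.

Lemma defn_not X (F : family M X) R : defn F R -> defn F (fun x => ~ R x).
Proof. exact: (definable_not pt (Delta0_class _)). Qed.

Lemma defn_imp X (F : family M X) R R' :
  defn F R -> defn F R' -> defn F (fun x => R x -> R' x).
Proof. exact: (definable_imp (Delta0_class _)). Qed.

Lemma defn_and X (F : family M X) R R' :
  defn F R -> defn F R' -> defn F (fun x => R x /\ R' x).
Proof. exact: (definable_and (Delta0_class _)). Qed.

Lemma defn_or X (F : family M X) R R' :
  defn F R -> defn F R' -> defn F (fun x => R x \/ R' x).
Proof. exact: (definable_or (Delta0_class _)). Qed.

Lemma defn_cst X (F : family M X) (Q : Prop) : defn F (fun=> Q).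
Proof. exact: (definable_cst pt (Delta0_class _)). Qed.

Lemma defn_ext X (F : family M X) R R' : (forall x, R x <-> R' x) -> defn F R -> defn F R'.
Proof. exact: definable_ext. Qed.

Lemma defn_bex X (F : family M X) (t : X -> D) (R : X -> D -> Prop) :
  tfun F t -> defn (extend F) (fun p => R p.1 p.2) ->
  defn F (fun x => exists2 d, mem d (t x) & R x d).
Proof.
move=> ht /defn_not hR.
have := @defn_ball X F t (fun x d => ~ R x d) ht hR.
move=> /defn_not; apply: defn_ext => x; split.
  by move=> h; apply: NNPP => n; apply: h => d dt Rd; apply: n; exists d.
by move=> [d dt Rd] h; apply: h dt Rd.
Qed.

Lemma defn1_last X (F : family M X) (R : D -> Prop) :
  defn1 R -> defn (extend F) (fun p => R p.2).
Proof. exact: (definable_last pt (Delta0_class _)). Qed.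

Ltac tfun_tac := first
  [ eassumption | apply: tfun_last | apply: tfun_cst
  | apply: tfun_V; tfun_tac | apply: tfun_P; tfun_tac
  | apply: tfun_cons; [reflexivity|rewrite /=; tfun_tac] ].

Lemma defn_sub X (F : family M X) f g :
  tfun F f -> tfun F g -> defn F (fun x => sub (f x) (g x)).
Proof. by move=> hf hg; apply: defn_ball => //; apply: defn_mem; tfun_tac. Qed.

Lemma defn_trans X (F : family M X) f : tfun F f -> defn F (fun x => trans (f x)).
Proof. by move=> hf; apply: defn_ball => //; apply: defn_sub; tfun_tac. Qed.

Ltac defn_tac := repeat first
  [ apply: defn_mem | apply: defn_eq | apply: defn_sub | apply: defn_trans
  | apply: defn_and | apply: defn_or | apply: defn_ball | apply: defn_bex
  | apply: defn_not | apply: defn_cst | apply: defn_imp | tfun_tac ].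

Lemma ext x y : (forall z, mem z x <-> mem z y) -> x = y.
Proof.
move=> h; have := EA_M EA_ext (@econs _ _ M tt x (@econs _ _ M tt y (fun s _ => pt s))).
rewrite /= => -[_ h']; apply/strictM/h' => d.
by have [] := h d.
Qed.

Lemma pow x y : mem y (P x) <-> sub y x.
Proof.
have := EA_M EA_pow (@econs _ _ M tt y (@econs _ _ M tt x (fun s _ => pt s))).
by rewrite /= => -[h h']; split.
Qed.

Lemma V_spec x y : mem y (V x) <-> exists2 z, mem z x & sub y (V z).
Proof.
have := EA_M EA_V (@econs _ _ M tt y (@econs _ _ M tt x (fun s _ => pt s))).
rewrite /= => -[h h']; split=> [/h [z [zx]]|[z zx yz]]; first by move=> /pow; exists z.
by apply: h'; exists z; split=> //; apply/pow.
Qed.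

Lemma defn1_formula R : defn1 R ->
  exists A (e : env M), Delta0 A /\ forall d : D, R d <-> sat (@econs _ _ M tt d e) A.
Proof.
move=> [A [e1 [KA /(good_env_cons pt) [r [e' [eF' ee']]] h]]].
exists (ren r A), (e' tt); split; first exact: Delta0_ren.
by move=> d; rewrite (h (tt, d)) ee' sat_ren.
Qed.

Lemma sep R x : defn1 R -> exists y, forall z, mem z y <-> mem z x /\ R z.
Proof.
move=> /defn1_formula [A [e [KA h]]].
pose A' := ren (@up_ren (set_sig fun_EA) tt (@shift (set_sig fun_EA) tt)) A.
have KA' : Delta0 A' by apply: Delta0_ren.
have := EA_M (EA_sep KA') (@econs _ _ M tt x e); rewrite /= => -[y hy].
exists y => z; rewrite h; move: (hy z); rewrite sat_at_var /A' sat_ren econs_up_ren /=.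
rewrite [X in sat (econs _ X) A](_ : _ = e) //.
by apply: functional_extensionality_dep => -[].
Qed.

Lemma ind R : defn1 R -> (exists2 x, (forall y, ~ mem y x) & R x) ->
  (forall x y z, R x -> R y -> (forall w, mem w z <-> mem w x \/ w = y) -> R z) ->
  forall x, R x.
Proof.
move=> /defn1_formula [A [e [KA h]]] [x0 x00 Rx0] step x; apply/h.
have := EA_M (EA_ind KA) e; rewrite /=; apply; split.
  by exists x0; split; [apply: x00|apply/h].
move=> a b c [] /sat_at_var Ra [] /sat_at_var Rb hw; apply/sat_at_var.
have E : (fun (s : unit) i => @econs _ _ M tt c (@econs _ _ M tt b (@econs _ _ M tt a e)) s (3 + i)) = e.
  by apply: functional_extensionality_dep => -[].
move: Ra Rb; rewrite /= E -!h => Ra Rb; apply: step Ra Rb _ => w.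
have := hw w; rewrite /= => -[h1 h2]; split=> [/h1 [wx|/strictM]|h'].
- by left.
- by right.
by apply: h2; case: h'; [left|right; apply/strictM].
Qed.

Lemma V_mono x y : sub x y -> sub (V x) (V y).
Proof. exact: rank_mono V_spec _ _. Qed.

Lemma mem_V z x y : mem z x -> sub y (V z) -> mem y (V x).
Proof. exact: rank_mem V_spec _ _ _. Qed.

Lemma sub_antisym x y : sub x y -> sub y x -> x = y.
Proof. by move=> xy yx; apply: ext => z; split; [apply: xy|apply: yx]. Qed.

Lemma V_sub x y z : mem y (V x) -> sub z y -> mem z (V x).
Proof. by move=> /V_spec [u ux yu] zy; apply: mem_V ux _; apply: incl_trans yu. Qed.

Definition adjoined x y z := forall w, mem w z <-> mem w x \/ w = y.

Lemma V_adjoined x y z w : adjoined x y z -> mem w (V z) <-> mem w (V x) \/ sub w (V y).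
Proof.
move=> xyz; split=> [/V_spec [u /xyz [ux|->] wu]|[/V_spec [u ux wu]|wy]].
- by left; apply: mem_V wu.
- by right.
- by apply: mem_V wu; apply/xyz; left.
by apply: mem_V wy; apply/xyz; right.
Qed.

Lemma exists_empty : exists x, forall y, ~ mem y x.
Proof.
have [|x xP] := @sep (fun=> False) o; first exact: defn_cst.
by exists x => y /xP [].
Qed.

(** Adduction induction for the statement that all elements of [x] have the
    property [R] amounts to induction on membership for [R]. *)
Lemma in_ind R : defn1 R -> in_induction mem R.
Proof.
move=> hR step.
suff allR x : forall y, mem y x -> R y by move=> x; apply/step/allR.
move: x; apply: ind.
- by apply: defn_ball; [apply: tfun_last|apply: defn1_last].
- by have [x x0] := exists_empty; exists x => // y /x0.
by move=> x y z Rx Ry xyz w /xyz [/Rx|->] //; apply: step.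
Qed.

Lemma sub_V x : sub x (V x).
Proof. by apply: (rank_incl V_spec); apply: in_ind; rewrite /defn1; defn_tac. Qed.

Lemma trans_V x : trans (V x).
Proof. by apply: (rank_transitive V_spec); apply: in_ind; rewrite /defn1; defn_tac. Qed.

Lemma V_V x : sub (V (V x)) (V x).
Proof. by apply: (rank_idem V_spec); apply: in_ind; rewrite /defn1; defn_tac. Qed.

Lemma V_compare x y : mem (V x) (V y) \/ sub (V y) (V x).
Proof.
apply: (@rank_compare _ _ _ V_spec (mem^~ (P (V x)))); last exact/pow/sub_V.
  by move=> a b /pow ax /ax bV; apply/pow/trans_V.
apply: in_ind; apply: (@defn_ball _ _ (fun=> P (V x))
  (fun p x => mem (V x) (V p.2) \/ sub (V p.2) (V x))); first exact: tfun_cst.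
by defn_tac.
Qed.

(** Otherwise [V x] would contain all its subsets, among them its Russell set. *)
Lemma V_irrefl x : ~ mem (V x) (V x).
Proof.
move=> xx; have [|r rP] := @sep (fun y => ~ mem y y) (V x).
  by rewrite /defn1; defn_tac.
have rx : mem r (V x) by apply: V_sub xx _ => w /rP [].
by case: (classic (mem r r)) => rr; [case/rP: (rr)|case: (rr); apply/rP].
Qed.

(** Bounded versions of the definitions that go into HF, so that adduction induction
    applies to statements about them. *)
Definition zero_or_succ b := (forall c, mem c b -> False) \/
  exists2 g, mem g b & (forall c, mem c b -> mem c g \/ c = g) /\ sub g b.

Definition natural n := [/\ trans n, forall y, mem y n -> trans y,
  zero_or_succ n & forall b, mem b n -> zero_or_succ b].

Lemma defn_natural X (F : family M X) f :
  tfun F f -> defn F (fun x => natural (f x)).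
Proof.
move=> hf; pose N n := (trans n /\ (forall y, mem y n -> trans y)) /\
  (zero_or_succ n /\ forall b, mem b n -> zero_or_succ b).
apply: (@defn_ext _ _ (fun x => N (f x))).
  by move=> x; split=> [[[? ?] [? ?]]|[? ? ? ?]].
by rewrite /N /zero_or_succ; defn_tac.
Qed.

(** When [u] is adjoined to [x], the value of V either remains [V x] or becomes the
    power set of [V u], by comparability; in the latter case the successor of the rank
    of [u] is the rank.  A rank of [x] is a subset of [V x], which bounds the
    quantifier and makes the induction available. *)
Lemma exists_rank x : exists n, natural n /\ V n = V x.
Proof.
suff [n _ nP] : exists2 n, mem n (P (V x)) & natural n /\ V n = V x by exists n.
move: x; apply: ind.
- rewrite /defn1; apply: defn_bex; first by defn_tac.
  by apply: defn_and; [apply: defn_natural; defn_tac|defn_tac].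
- have [x x0] := exists_empty; exists x => //; exists x; first exact/pow/sub_V.
  by split=> //; split=> [y /x0|y /x0||y /x0] //; left.
move=> x u z [n nx [nn nV]] [m mu [[mt mtt m0 ms] mV]] xuz.
have xz : sub (V x) (V z) by move=> w wx; apply/(V_adjoined _ xuz); left.
case: (V_compare x z) => [/(V_adjoined _ xuz)|zx]; last first.
  have e := sub_antisym zx xz; exists n; last by rewrite e.
  by apply/pow; rewrite e -nV; apply: sub_V.
case=> [/V_irrefl //|xu].
have [|k kP] := @sep (fun c => mem c m \/ c = m) (P (V u)).
  by rewrite /defn1; defn_tac.
have mk : adjoined m m k.
  move=> c; rewrite kP; split=> [[]//|cm]; split=> //.
  case: cm => [cm|->] //; apply/pow; rewrite -mV; apply: trans_V; exact: sub_V.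
have kV : V k = V z.
  apply: ext => w; rewrite (V_adjoined _ mk) (V_adjoined _ xuz) mV; split.
    by case=> [/trans_V|]; right.
  by case=> [/xu/trans_V|]; right.
exists k; first by rewrite -kV; apply/pow/sub_V.
split=> //; split.
- by move=> y /mk [/mt ym|->] w wy; apply/mk; left; [apply: ym|].
- by move=> y /mk [/mtt|->].
- right; exists m; first by apply/mk; right.
  by split=> [c /mk //|c cm]; apply/mk; left.
by move=> b /mk [/ms|->].
Qed.

(** * The types over a rank in a model of EA^set *)

Section TypeStructure.
Variable w : D.

(** Type 0 is the power set of [V w] and not [V w]: the ranks of the elements of
    [V w] may be subsets of [V w] without being elements of it. *)
Fixpoint level n : D := if n is m.+1 then P (level m) else P (V w).

Lemma V_level0 x : mem x (level 0) -> mem (V x) (level 0).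
Proof.
move=> /pow xw; apply/pow; apply: incl_trans (@V_V w); exact: V_mono.
Qed.

Definition types : structure H_sig :=
  @Structure H_sig (fun n => {x | mem x (level n)})
    (fun _ x y => sval x = sval y)
    (fun _ x => exist _ (V (sval x)) (V_level0 (proj2_sig x)))
    (fun p => match p with
      | pIn => fun x y => mem (sval x) (sval y)
      | pEps n => fun x y => mem (sval x) (sval y)
      end).

Lemma types_congruent : congruent types.
Proof.
split=> //= [s x y z -> //|f x y -> //|].
by case=> [|n] x x' y y' /= -> ->.
Qed.

Definition vals (e : env types) : nat -> nat -> D := fun s i => sval (e s i).

Fixpoint eval_in (e : nat -> nat -> D) s (t : @term H_sig s) : D :=
  match t with Var s i => e s i | App _ t => V (eval_in e t) end.

Definition vcons (s : nat) (d : D) (e : nat -> nat -> D) : nat -> nat -> D :=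
  fun s' i => if PeanoNat.Nat.eq_dec s s' then (if i is j.+1 then e s' j else d)
    else e s' i.

(** Truth in the type structure, with values in the model itself: being elements of a
    level is no longer part of the type of the values. *)
Fixpoint sat_in (e : nat -> nat -> D) (A : H_form) : Prop :=
  match A with
  | Eq _ t u => eval_in e t = eval_in e u
  | Rel _ t u => mem (eval_in e t) (eval_in e u)
  | Bot => False
  | Imp A B => sat_in e A -> sat_in e B
  | And A B => sat_in e A /\ sat_in e B
  | Or A B => sat_in e A \/ sat_in e B
  | All s A => forall d, mem d (level s) -> sat_in (vcons s d e) A
  | Ex s A => exists2 d, mem d (level s) & sat_in (vcons s d e) A
  end.

Lemma vals_econs s (d : dom types s) e : vals (econs d e) = vcons s (sval d) (vals e).
Proof.
apply: functional_extensionality => s'; apply: functional_extensionality => i.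
rewrite /vals /vcons /econs /dec /H_sort_dec.
by case: (PeanoNat.Nat.eq_dec s s') => // h; case: s' / h; case: i.
Qed.

Lemma eval_vals (e : env types) s (t : @term H_sig s) :
  sval (eval e t) = eval_in (vals e) t.
Proof. by elim: t => //= f t ->. Qed.

Lemma sat_vals A : forall e : env types, sat e A <-> sat_in (vals e) A.
Proof.
elim: A => //= [s t u|p t u|A IA B IB|A IA B IB|A IA B IB|s A IA|s A IA] e;
  rewrite ?IA ?IB //.
- by rewrite !eval_vals.
- by rewrite -!eval_vals; case: p t u.
- split=> [h d ds|h [d ds]]; last by rewrite IA vals_econs; apply: h.
  by have := h (exist _ d ds); rewrite IA vals_econs.
split=> [[[d ds]]|[d ds]].
  by rewrite IA vals_econs; exists d.
by exists (exist _ d ds); rewrite IA vals_econs.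
Qed.

Lemma tfun_eval_in X (F : family M X) (e : X -> nat -> nat -> D) s (t : @term H_sig s) :
  (forall s i, tfun F (fun x => e x s i)) -> tfun F (fun x => eval_in (e x) t).
Proof. by move=> eF; elim: t => //= f t IH; apply: tfun_V. Qed.

Lemma tfun_vcons X (F : family M X) (e : X -> nat -> nat -> D) s :
  (forall s i, tfun F (fun x => e x s i)) ->
  forall s' i, tfun (extend F) (fun p => vcons s p.2 (e p.1) s' i).
Proof.
move=> eF s' i; have eF' j : tfun (extend F) (fun p => e p.1 s' j).
  by apply: tfun_cons => //; apply: eF.
rewrite /vcons; case: PeanoNat.Nat.eq_dec => h; last exact: eF'.
by case: i => [|i]; [apply: tfun_last|apply: eF'].
Qed.

(** All quantifiers range over sets, so the higher-order formulas define
    classes that separation applies to. *)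
Lemma defn_sat_in A : forall X (F : family M X) (e : X -> nat -> nat -> D),
  (forall s i, tfun F (fun x => e x s i)) -> defn F (fun x => sat_in (e x) A).
Proof.
elim: A => /= [s t u|p t u||A IA B IB|A IA B IB|A IA B IB|s A IA|s A IA] X F e eF.
- by apply: defn_eq; apply: tfun_eval_in.
- by apply: defn_mem; apply: tfun_eval_in.
- exact: defn_cst.
- by apply: defn_imp; [apply: IA|apply: IB].
- by apply: defn_and; [apply: IA|apply: IB].
- by apply: defn_or; [apply: IA|apply: IB].
- apply: (@defn_ball _ _ (fun=> level s) (fun x d => sat_in (vcons s d (e x)) A));
    first exact: tfun_cst.
  exact/IA/tfun_vcons.
apply: (@defn_bex _ _ (fun=> level s) (fun x d => sat_in (vcons s d (e x)) A));
  first exact: tfun_cst.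
exact/IA/tfun_vcons.
Qed.

Lemma level0P x : mem x (level 0) <-> sub x (V w).
Proof. exact: pow. Qed.

Lemma level0_trans x y : mem x (level 0) -> mem y x -> mem y (level 0).
Proof. by move=> /level0P xw /xw yw; apply/level0P/trans_V. Qed.

Lemma dom0_ext (x y : dom types 0) :
  (forall d : dom types 0, mem (sval d) (sval x) <-> mem (sval d) (sval y)) -> sval x = sval y.
Proof.
case: x y => [x xl] [y yl] /= h; apply: ext => z.
by split=> [zx|zy]; [have := h (exist _ z (level0_trans xl zx))|
  have := h (exist _ z (level0_trans yl zy))] => /= -[]; auto.
Qed.

Lemma types_models : models types Homega.
Proof.
move=> _ [n|n A|||] e.
- move=> /= h; case Ex: (e n.+1 0) h => [x xn]; case Ey: (e n.+1 1) => [y yn] h /=.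
  apply: ext => z; have zn u : mem u (level n.+1) -> mem z u -> mem z (level n).
    by move=> /pow; apply.
  have hz : forall d : dom types n, mem (sval d) x <-> mem (sval d) y.
    move=> d; have := h d; by rewrite !econs0 !econs_succ Ex Ey => -[h1 h2]; split.
  by split=> hz'; [have := hz (exist _ z (zn _ xn hz'))|
    have := hz (exist _ z (zn _ yn hz'))] => /= -[]; auto.
- pose R z := sat_in (vcons n z (vals e)) A.
  have [|y yP] := @sep R (level n).
    apply: (@defn_sat_in A _ _ (fun p => vcons n p.2 (vals e))) => s i.
    by apply: (tfun_vcons (e := fun=> vals e)) => s' i'; apply: tfun_cst.
  have yn : mem y (level n.+1) by apply/pow => z /yP [].
  apply: (ex_intro _ (exist _ y yn : dom types n.+1)) => d.
  apply: (iffRL (sat_Iff (econs d (econs (exist _ y yn : dom types n.+1) e))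
    (hEps (hv n 0) (hv n.+1 0)) (ren (@shift H_sig n.+1) A))).
  have E : econs d (econs (exist _ y yn : dom types n.+1) e) n.+1 0 = exist _ y yn.
    by rewrite econs_succ econs0.
  have A_iff : sat (econs d (econs (exist _ y yn : dom types n.+1) e))
      (ren (@shift H_sig n.+1) A) <-> mem (sval d) y.
    rewrite yP sat_ren /R -vals_econs -sat_vals.
    have dn : mem (sval d) (level n) := proj2_sig d.
    by rewrite econs_succ_comm econs_shift; split=> [|[]].
  by rewrite A_iff [sat _ (hEps _ _)]/= E econs0.
- split=> [h d|h]; first by split; rewrite /= in h *; rewrite h.
  apply: dom0_ext => d; have [h1 h2] := h d.
  by split.
- have [|y yP] := @sep (mem^~ (sval (e 1 0))) (sval (e 0 0)).
    by rewrite /defn1; defn_tac.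
  have yl : mem y (level 0).
    by apply/level0P => z /yP [zx _]; exact: (proj1 (level0P _) (proj2_sig (e 0 0))).
  by exists (exist _ y yl) => d /=; split=> [/yP|h]; last apply/yP.
have yl := proj2_sig (e 0 0); have xl := proj2_sig (e 0 1).
split=> /= [/V_spec [z zx yz]|[[z zl] /= [zx yz]]].
  by exists (exist _ z (level0_trans xl zx)); split=> //= u; apply: yz.
apply: mem_V zx _ => u uy.
exact: (yz (exist _ u (level0_trans yl uy))).
Qed.

Lemma sat_hTrans (e : env types) i : sat e (hTrans (v i)) <-> trans (sval (e 0 i)).
Proof.
split=> h; last by move=> y yx z zy; exact: (h _ yx _ zy).
move=> y yx z zy; have yl := level0_trans (proj2_sig (e 0 i)) yx.
exact: (h (exist _ y yl) yx (exist _ z (level0_trans yl zy)) zy).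
Qed.

Definition ordinal x := trans x /\ forall y, mem y x -> trans y.

Lemma sat_hOrd (e : env types) i : sat e (hOrd (v i)) <-> ordinal (sval (e 0 i)).
Proof.
split=> [[/sat_hTrans h1 h2]|[h1 h2]]; split=> //.
- move=> y yx; pose y' : dom types 0 := exist _ y (level0_trans (proj2_sig (e 0 i)) yx).
  have := h2 y' yx; exact: (proj1 (@sat_hTrans (econs y' e) 0)).
- exact/sat_hTrans.
move=> y yx; apply: (proj2 (@sat_hTrans (econs y e) 0)); exact: h2.
Qed.

Lemma sat_zero_or_succ (e : env types) i : ordinal (sval (e 0 i)) ->
  zero_or_succ (sval (e 0 i)) ->
  sat e (Or (hZero (v i)) (hEx 0 (And (hOrd (v 0)) (hSucc (v 0) (v i.+1))))).
Proof.
move=> [bt btt] [b0|[g gb [bg gsub]]]; [left|right].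
  by move=> c cb; apply: b0 cb.
pose g' : dom types 0 := exist _ g (level0_trans (proj2_sig (e 0 i)) gb).
exists g'; split.
  apply: (proj2 (@sat_hOrd (econs g' e) 0)); split; first exact: btt.
  by move=> y yg; apply/btt/gsub.
move=> c; split=> [/bg|[/gsub //|]]; first exact.
by move=> /= cg; rewrite /= cg.
Qed.

Lemma sat_hNat (e : env types) i : natural (sval (e 0 i)) -> sat e (hNat (v i)).
Proof.
move=> [nt ntt n0 nS]; have no : ordinal (sval (e 0 i)) by [].
split; first exact/sat_hOrd.
move=> b [_ bn]; apply: (@sat_zero_or_succ (econs b e) 0).
  case: bn => [bn|/= ->] //; split; first exact: ntt.
  by move=> y yb; apply: ntt; apply: nt yb.
by case: bn => [bn|/= ->] //; apply: nS.
Qed.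

Lemma mem_V_level0 x : mem x (V w) -> mem x (level 0).
Proof. by move=> xw; apply/level0P/trans_V. Qed.

Lemma in_HF_types (x : dom types 0) : mem (sval x) (V w) -> in_HF x.
Proof.
move=> xw e ex; have [n [nn nV]] := exists_rank w.
have nl : mem n (level 0) by apply/level0P; rewrite -nV; apply: sub_V.
exists (exist _ n nl : dom types 0); split; first exact: sat_hNat.
have : mem (sval (e 0 0)) (V n) by rewrite ex nV.
exact.
Qed.

Lemma types_transfer (A : V_form) (e : env types) (e' : env (EA_reduct M)) :
  Delta0 A -> (forall i, sval (e 0 i) = e' tt i /\ mem (e' tt i) (V w)) ->
  sat e (relHF A) <-> sat e' A.
Proof.
move=> A0 ee'; apply: (@Delta0_transfer types (EA_reduct M)
  (fun x y => sval x = y /\ mem y (V w))) => //.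
- move=> x y [/= -> yw]; split=> //; case/V_spec: yw => z zw yz.
  apply: mem_V zw _; apply: incl_trans (@V_V z); exact: V_mono.
- by move=> x y x' y' [<- _] [<- _]; rewrite /=; split=> [->|/strictM]; first apply/strictM.
- by move=> x y x' y' [<- _] [<- _].
- move=> x y x' [<- xw] x'x; exists (sval x') => //; split=> //.
  exact: trans_V xw _ x'x.
move=> x y y' [<- xw] y'x; have y'w := trans_V xw y'x.
exists (exist _ y' (mem_V_level0 y'w)); split=> //.
exact: in_HF_types.
Qed.

Lemma mem_VP x y : sub y (V x) -> mem y (V (P (V x))).
Proof. by apply: mem_V; apply/pow/sub_V. Qed.

Lemma level_inhabited s : exists x, mem x (level s).
Proof. by case: s => [|s]; [exists (V w)|exists (level s)]; apply/pow. Qed.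

End TypeStructure.

(** A tuple of sets is contained in some [V w], by comparability, and then all its
    members are in the class HF of the types over [V w]. *)
Lemma types_Pi1 (A : V_form) : Pi1 A -> forall E : env (EA_reduct M),
  (exists w, forall i, mem (E tt i) (V w)) ->
  (forall w (e : env (types w)),
    (forall i, sval (e 0 i) = E tt i /\ mem (E tt i) (V w)) -> sat e (relHF A)) ->
  sat E A.
Proof.
elim=> {A} [A A0|A _ IH] E [w Ew] h.
  pose e s i : dom (types w) s := match s with
    | 0 => exist _ (E tt i) (mem_V_level0 (Ew i))
    | s => let (x, xs) := constructive_indefinite_description _ (level_inhabited w s) in
       exist _ x xs end.
  by apply/(@types_transfer w A e E); first exact: A0; [|apply: h].
move=> d; apply: IH => [|w' e he].
  (* Subsets of [V u] are elements of V of the power set of [V u]. *)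
  suff [u [du wu]] : exists u, sub d (V u) /\ sub (V w) (V u).
    exists (P (V u)) => -[|i]; first exact: mem_VP.
    by apply: mem_VP; apply: incl_trans wu; apply: trans_V; apply: Ew.
  case: (V_compare w d) => [wd|dw].
    by exists d; split; [apply: sub_V|apply: trans_V].
  by exists w; split=> //; apply: incl_trans dw; apply: sub_V.
pose e1 : env (types w') := fun s => match s return nat -> dom (types w') s with
  | 0 => fun i => e 0 i.+1 | s'.+1 => e s'.+1 end.
have e1_cons : econs (e 0 0) e1 = e.
  apply: functional_extensionality_dep => s.
  by apply: functional_extensionality => i; case: s => // ; case: i.
have h1 : sat e1 (relHF (sAll A)) by apply: h => i; apply: (he i.+1).
have := h1 (e 0 0); rewrite e1_cons; apply; apply: in_HF_types (erefl _).
by case: (he 0) => ->.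
Qed.

(** As [A] is a sentence, a constant environment will do; its value is contained in a
    set of the form [V w]. *)
Lemma sat_of_H_provable (A : V_form) (e : env M) :
  sentence A -> Pi1 A -> provable Homega (relHF A) -> sat e (V_to_EA A).
Proof.
move=> cA pA HA; apply/sat_V_to_EA.
apply/(@sat_sentence _ _ (EA_reduct M) A e (fun s _ => pt s) cA).
apply: types_Pi1 => //.
  by exists (P (V o)) => i; apply: mem_VP; apply: sub_V.
move=> w e' _; apply: (soundness (@types_congruent w) (@types_models w) HA) => B [].
Qed.

End EAModel.

(** * Models of H^ω *)

Section HModel.
Variables (N : structure H_sig) (strictN : strict N) (H_N : models N Homega).
Variable hpt : forall s, dom N s.

Definition hmem (x y : dom N 0) : Prop := @rint _ N pIn x y.
Definition eps n (x : dom N n) (y : dom N n.+1) : Prop := @rint _ N (pEps n) x y.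
Definition hV (x : dom N 0) : dom N 0 := @fint _ N tt x.
Notation hsub := (incl hmem).
Notation htrans := (transitive_set hmem).

Definition hdef X (F : family N X) (R : X -> Prop) : Prop := definable (fun=> True) F R.
Definition htf X (F : family N X) n (f : X -> dom N n) : Prop := term_fun F f.
Definition hcons X (F : family N X) n : family N (X * dom N n) := cons_var F.
Definition hdef1 n (R : dom N n -> Prop) : Prop :=
  hdef (@hcons _ (@no_var _ N unit) n) (fun p => R p.2).

Lemma all_class : formula_class (L := H_sig) (fun=> True).
Proof. by []. Qed.

Lemma htf_V X (F : family N X) (f : X -> dom N 0) : htf F f -> htf F (fun x => hV (f x)).
Proof. exact: (@term_fun_app _ N X F tt). Qed.

Lemma htf_last X (F : family N X) n : htf (@hcons X F n) (fun p => p.2).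
Proof. exact: (term_fun_last hpt). Qed.

Lemma htf_cst X (F : family N X) n (c : dom N n) : htf F (fun=> c).
Proof. exact: (term_fun_cst hpt). Qed.

Lemma htf_cons X (F : family N X) n m (f : X * dom N n -> dom N m) :
  (forall x d d', f (x, d) = f (x, d')) ->
  htf F (fun x => f (x, hpt n)) -> htf (@hcons X F n) f.
Proof. exact: (term_fun_cons (pt := hpt)). Qed.

Lemma hdef_ext X (F : family N X) R R' :
  (forall x, R x <-> R' x) -> hdef F R -> hdef F R'.
Proof. exact: definable_ext. Qed.

Lemma hdef_mem X (F : family N X) (f g : X -> dom N 0) :
  htf F f -> htf F g -> hdef F (fun x => hmem (f x) (g x)).
Proof. exact: (@definable_Rel _ _ N _ all_class X F pIn). Qed.

Lemma hdef_eps X (F : family N X) n (f : X -> dom N n) (g : X -> dom N n.+1) :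
  htf F f -> htf F g -> hdef F (fun x => eps (f x) (g x)).
Proof. exact: (@definable_Rel _ _ N _ all_class X F (pEps n)). Qed.

Lemma hdef_eq X (F : family N X) n (f g : X -> dom N n) :
  htf F f -> htf F g -> hdef F (fun x => f x = g x).
Proof.
move=> hf hg; apply: definable_ext (definable_Eq all_class hf hg).
by move=> x; apply: strictN.
Qed.

Lemma hdef_all X (F : family N X) n (R : X -> dom N n -> Prop) :
  hdef (@hcons X F n) (fun p => R p.1 p.2) -> hdef F (fun x => forall d, R x d).
Proof. exact: (definable_all hpt all_class). Qed.

Lemma hdef_ex X (F : family N X) n (R : X -> dom N n -> Prop) :
  hdef (@hcons X F n) (fun p => R p.1 p.2) -> hdef F (fun x => exists d, R x d).
Proof. exact: (definable_ex hpt all_class). Qed.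

Lemma hdef_not X (F : family N X) R : hdef F R -> hdef F (fun x => ~ R x).
Proof. exact: (definable_not hpt all_class). Qed.

Lemma hdef_imp X (F : family N X) R R' :
  hdef F R -> hdef F R' -> hdef F (fun x => R x -> R' x).
Proof. exact: (definable_imp all_class). Qed.

Lemma hdef_and X (F : family N X) R R' :
  hdef F R -> hdef F R' -> hdef F (fun x => R x /\ R' x).
Proof. exact: (definable_and all_class). Qed.

Lemma hdef_or X (F : family N X) R R' :
  hdef F R -> hdef F R' -> hdef F (fun x => R x \/ R' x).
Proof. exact: (definable_or all_class). Qed.

Lemma hdef_cst X (F : family N X) (Q : Prop) : hdef F (fun=> Q).
Proof. exact: (definable_cst hpt all_class). Qed.

Ltac htf_tac := first
  [ eassumption | apply: htf_last | apply: htf_cst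
  | apply: htf_V; htf_tac
  | apply: htf_cons; [reflexivity|rewrite /=; htf_tac] ].

Lemma hdef1_last X (F : family N X) n (R : dom N n -> Prop) :
  hdef1 R -> hdef (@hcons X F n) (fun p => R p.2).
Proof. exact: (definable_last hpt all_class). Qed.

Lemma hdef_sub X (F : family N X) f g :
  htf F f -> htf F g -> hdef F (fun x => hsub (f x) (g x)).
Proof.
by move=> hf hg; apply: hdef_all; apply: hdef_imp; apply: hdef_mem; htf_tac.
Qed.

Lemma hdef_trans X (F : family N X) f : htf F f -> hdef F (fun x => htrans (f x)).
Proof.
move=> hf; apply: hdef_all; apply: hdef_imp; first by apply: hdef_mem; htf_tac.
by apply: hdef_sub; htf_tac.
Qed.

(** Objects of type 0 have elements of type 0 and objects of type n+1 have elements of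
    type n; as the predecessor of 0 is 0, both cases have elements of type [k.-1]. *)
Definition kid k : dom N k -> dom N k.-1 -> Prop :=
  match k return dom N k -> dom N k.-1 -> Prop with
  | 0 => fun x y => hmem y x
  | k.+1 => fun x y => eps y x
  end.

Lemma hdef_kid X (F : family N X) k (f : X -> dom N k) (g : X -> dom N k.-1) :
  htf F f -> htf F g -> hdef F (fun x => kid (f x) (g x)).
Proof.
by case: k f g => [|k] f g hf hg; [apply: hdef_mem|apply: hdef_eps].
Qed.

Ltac hdef_tac := repeat first
  [ apply: hdef_mem | apply: hdef_eps | apply: hdef_kid | apply: hdef_eq
  | apply: hdef_sub | apply: hdef_trans
  | apply: hdef_and | apply: hdef_or | apply: hdef_not | apply: hdef_cst
  | apply: hdef_imp | apply: hdef_all | apply: hdef_ex | htf_tac ].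

Lemma hdef1_formula n (R : dom N n -> Prop) : hdef1 R ->
  exists A (e : env N), forall d : dom N n, R d <-> sat (econs d e) A.
Proof.
move=> [A [e1 [KA /(good_env_cons hpt) [r [e' [eF' ee']]] h]]].
exists (ren r A), (e' tt).
by move=> d; rewrite (h (tt, d)) ee' sat_ren.
Qed.

Lemma compr n (R : dom N n -> Prop) : hdef1 R ->
  exists X : dom N n.+1, forall y, eps y X <-> R y.
Proof.
move=> /hdef1_formula [A [e h]]; have [X hX] := H_N (@H_compr n A) e.
exists X => y.
have := iffLR (sat_Iff (econs y (econs (X : dom N n.+1) e))
  (hEps (hv n 0) (hv n.+1 0)) (ren (@shift H_sig n.+1) A)) (hX y).
by rewrite econs_succ_comm sat_shift -h /= -econs_succ_comm econs0 econs_succ econs0.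
Qed.

Lemma hext_type n (x y : dom N n.+1) : (forall z, eps z x <-> eps z y) -> x = y.
Proof.
move=> h; pose e : env N := @econs _ H_sort_dec N n.+1 x (@econs _ H_sort_dec N n.+1 y (fun s _ => hpt s)).
have [ex ey] : e n.+1 0 = x /\ e n.+1 1 = y by rewrite /e econsS !econs0.
have : (forall d : dom N n, eps (econs d e n 0) (econs d e n.+1 0) <->
    eps (econs d e n 0) (econs d e n.+1 1)) -> deq (e n.+1 0) (e n.+1 1).
  exact: (H_N (H_ext_type n) e).
rewrite ex ey => he; apply/strictN/he => d.
by rewrite !econs_succ econs0 ex ey.
Qed.

Lemma hext (x y : dom N 0) : (forall z, hmem z x <-> hmem z y) -> x = y.
Proof.
move=> h; have := H_N H_ext (econs (x : dom N 0) (econs (y : dom N 0) (fun s _ => hpt s))).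
rewrite /= => -[_ h']; apply/strictN/h' => d.
by have [] := h d.
Qed.

Lemma hsep R x : hdef1 R -> exists y, forall z, hmem z y <-> hmem z x /\ R z.
Proof.
move=> /compr [Y hY].
pose e : env N := fun s => match s return nat -> dom N s with
  0 => fun=> x | 1 => fun=> Y | s => fun=> hpt s end.
have [y hy] := H_N H_sep e; exists y => z.
by have := hy z; rewrite /= -hY => -[h1 h2]; split.
Qed.

Lemma hV_spec x y : hmem y (hV x) <-> exists2 z, hmem z x & hsub y (hV z).
Proof.
have := H_N H_V (econs (y : dom N 0) (econs (x : dom N 0) (fun s _ => hpt s))).
rewrite /= => -[h h']; split=> [/h [z [zx yz]]|[z zx yz]]; first by exists z.
by apply: h'; exists z.
Qed.

Lemma kid_ext k (x y : dom N k) : (forall c, kid x c <-> kid y c) -> x = y.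
Proof. by case: k x y => [|k] x y; [apply: hext|apply: hext_type]. Qed.

Lemma kid_sep k (R : dom N k.-1 -> Prop) (x : dom N k) : hdef1 R ->
  exists y : dom N k, forall c, kid y c <-> kid x c /\ R c.
Proof.
case: k R x => [|k] R x hR; first exact: hsep.
have [|y yP] := @compr k (fun c => eps c x /\ R c); last by exists y.
by apply: hdef_and => //; apply: hdef_eps; htf_tac.
Qed.

Lemma hV_mono x y : hsub x y -> hsub (hV x) (hV y).
Proof. exact: rank_mono hV_spec _ _. Qed.

Lemma mem_hV z x y : hmem z x -> hsub y (hV z) -> hmem y (hV x).
Proof. exact: rank_mem hV_spec _ _ _. Qed.

(** Every class [R] has an element that is disjoint from it: otherwise the
    intersection [d] of the sets [hV x] with [R x] would contain all its subsets. *)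
Lemma foundation R : hdef1 R -> (exists x, R x) ->
  exists2 x, R x & forall y, hmem y x -> ~ R y.
Proof.
move=> hR [x0 Rx0]; apply: NNPP => noMin.
have desc x : R x -> exists2 y, hmem y x & R y.
  move=> Rx; apply: NNPP => no; apply: noMin; exists x => // y yx Ry.
  by apply: no; exists y.
(* [d] is the intersection of all [hV x] with [R x]. *)
have [|d dP] := @hsep (fun y => forall x, R x -> hmem y (hV x)) (hV x0).
  apply: hdef_all; apply: hdef_imp; last by hdef_tac.
  exact: hdef1_last.
have subd r : hsub r d -> hmem r d.
  have h x : R x -> hsub r d -> hmem r (hV x).
    move=> /desc [y yx Ry] rd; apply: mem_hV yx _ => z /rd /dP [_]; exact.
  by move=> rd; apply/dP; split=> [|x Rx]; apply: h.
have [|r rP] := @hsep (fun y => ~ hmem y y) d; first by rewrite /hdef1; hdef_tac.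
have rd : hmem r d by apply: subd => z /rP [].
by case: (classic (hmem r r)) => rr; [case/rP: (rr)|case: (rr); apply/rP].
Qed.

Lemma hin_ind R : hdef1 R -> in_induction hmem R.
Proof.
move=> hR step x; apply: NNPP => nRx.
have [||m nRm mP] := @foundation (fun x => ~ R x); first exact: hdef_not.
  by exists x.
by apply: nRm; apply: step => y /mP; apply: NNPP.
Qed.

Lemma htrans_V x : htrans (hV x).
Proof. by apply: (rank_transitive hV_spec); apply: hin_ind; rewrite /hdef1; hdef_tac. Qed.

Lemma hV_V x : hsub (hV (hV x)) (hV x).
Proof. by apply: (rank_idem hV_spec); apply: hin_ind; rewrite /hdef1; hdef_tac. Qed.

Lemma hV_compare y x : hmem (hV x) (hV y) \/ hsub (hV y) (hV x).
Proof.
apply: (@rank_compare _ _ _ hV_spec (fun=> True)) => //.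
by apply: hin_ind; rewrite /hdef1; hdef_tac.
Qed.

(** * The cumulative hierarchy over the types of a model of H^ω *)

Definition match_kids k l (r : dom N k.-1 -> dom N l.-1 -> Prop) (x : dom N k) (y : dom N l) :=
  (forall x', kid x x' -> exists y', kid y y' /\ r x' y') /\
  (forall y', kid y y' -> exists x', kid x x' /\ r x' y').

(** Equality across types: two objects represent the same set when their elements do.
    The recursion descends in both types, each of which stays at 0 once it is reached;
    between sets of type 0, extensionality makes this agree with equality ([sameE]). *)
Fixpoint same0 l : dom N 0 -> dom N l -> Prop :=
  match l with
  | 0 => fun x y => x = y
  | m.+1 => @match_kids 0 m.+1 (@same0 m)
  end.

Fixpoint same k : forall l, dom N k -> dom N l -> Prop :=
  match k with
  | 0 => same0
  | j.+1 => fun l => @match_kids j.+1 l (@same j l.-1)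
  end.

Lemma sameE k l (x : dom N k) (y : dom N l) :
  same x y <-> match_kids (@same k.-1 l.-1) x y.
Proof.
case: k x => [|k] //; case: l y => [|l] // y x; split=> [<-|[h1 h2]].
  by split=> c cx; exists c.
by apply: hext => c; split=> [/h1|/h2] [c' [? /= cc']]; [rewrite cc'|rewrite -cc'].
Qed.

(** Taking predecessors of all levels at once, one reaches type 0 everywhere, where
    predecessors stay at 0. *)
Lemma level_ind (P : nat -> nat -> nat -> Prop) : P 0 0 0 ->
  (forall k l m, P k.-1 l.-1 m.-1 -> P k l m) -> forall k l m, P k l m.
Proof.
move=> P0 PS; suff h n k l m : k <= n -> l <= n -> m <= n -> P k l m.
  move=> k l m; apply: (h (k + l + m)); last exact: leq_addl.
    by rewrite -addnA leq_addr.
  by rewrite addnAC leq_addl.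
elim: n k l m => [|n IH] k l m; first by rewrite !leqn0 => /eqP -> /eqP -> /eqP ->.
by move=> kn ln mn; apply/PS/IH; rewrite -subn1 leq_subLR.
Qed.

Lemma same_refl k (x : dom N k) : same x x.
Proof.
elim: k x => [|k IH] x //; apply/sameE; split=> c cx; by exists c.
Qed.

Lemma same_sym k l (x : dom N k) (y : dom N l) : same x y -> same y x.
Proof.
move: k l 0 x y; apply: level_ind => [x y -> //|k l m IH x y /sameE [h1 h2]].
apply/sameE; split=> c; [move=> /h2|move=> /h1] => -[c' [hc' cc']]; exists c'; split=> //;
  exact: IH.
Qed.

Lemma same_trans k l m (y : dom N l) (x : dom N k) (z : dom N m) :
  same x y -> same y z -> same x z.
Proof.
move: k l m y x z; apply: level_ind => [y x z -> //|].
move=> k l m IH y x z /sameE [h1 h2] /sameE [h3 h4]; apply/sameE; split=> c.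
  move=> /h1 [c' [/h3 [c'' [zc'' c'c'']] cc']]; exists c''; split=> //; exact: IH cc' c'c''.
move=> /h4 [c' [/h2 [c'' [xc'' c''c']] c'c]]; exists c''; split=> //; exact: IH c''c' c'c.
Qed.

Lemma hdef_match k l (r : dom N k.-1 -> dom N l.-1 -> Prop) :
  (forall X (F : family N X) f g, htf F f -> htf F g -> hdef F (fun x => r (f x) (g x))) ->
  forall X (F : family N X) f g, htf F f -> htf F g ->
    hdef F (fun x => @match_kids k l r (f x) (g x)).
Proof.
by move=> hr X F f g hf hg; rewrite /match_kids; hdef_tac; apply: hr; htf_tac.
Qed.

Lemma hdef_same k : forall l X (F : family N X) (f : X -> dom N k) (g : X -> dom N l),
  htf F f -> htf F g -> hdef F (fun x => same (f x) (g x)).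
Proof.
elim: k => [|k IH] l; last by apply: hdef_match; apply: IH.
elim: l => [|l IH]; last by apply: (@hdef_match 0 l.+1).
by move=> X F f g; apply: hdef_eq.
Qed.

Definition raw := {k & dom N k}.
Definition mk k (x : dom N k) : raw := existT _ k x.
Definition rmem (p q : raw) : Prop :=
  exists c, kid (projT2 q) c /\ same (projT2 p) c.
Definition req (p q : raw) : Prop := same (projT2 p) (projT2 q).
Definition rsub p q := forall r, rmem r p -> rmem r q.

Lemma rmem_mk k (x : dom N k) c : kid x c -> rmem (mk c) (mk x).
Proof. by move=> xc; exists c; split=> //; apply: same_refl. Qed.

Lemma rmem_req p p' q : req p p' -> rmem p q -> rmem p' q.
Proof.
move=> pp' [c [qc pc]]; exists c; split=> //.
exact: same_trans (same_sym pp') pc.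
Qed.

Lemma req_ext p q : req p q <-> (forall r, rmem r p <-> rmem r q).
Proof.
split=> [/sameE [h1 h2] r|h].
  split=> [[c [/h1 [c' [qc' cc']] rc]]|[c [/h2 [c' [qc' cc']] rc]]]; exists c'; split=> //.
    exact: same_trans rc cc'.
  exact: same_trans rc (same_sym cc').
apply/sameE; split=> c hc.
  have [c' [qc' cc']] := proj1 (h (mk c)) (rmem_mk hc); by exists c'.
have [c' [qc' cc']] := proj2 (h (mk c)) (rmem_mk hc); exists c'; split=> //.
exact: same_sym.
Qed.

Lemma rmem_reqr p q r : req p q -> rmem r p -> rmem r q.
Proof. by move=> /req_ext pq /pq. Qed.

Definition ksub k (x y : dom N k) := forall c, kid x c -> kid y c.

Lemma hdef_rmem k l X (F : family N X) (f : X -> dom N k) (g : X -> dom N l) :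
  htf F f -> htf F g -> hdef F (fun x => rmem (mk (f x)) (mk (g x))).
Proof.
move=> hf hg; rewrite /rmem /=; apply: hdef_ex; apply: hdef_and; first by apply: hdef_kid; htf_tac.
by apply: hdef_same; htf_tac.
Qed.

(** By separation at type 0 and by comprehension above it. *)
Lemma rsub_level p k (x : dom N k) : rsub p (mk x) ->
  exists y : dom N k, ksub y x /\ req p (mk y).
Proof.
move=> px; have [|y yP] := @kid_sep k (fun c => rmem (mk c) p) x.
  by case: p px => l p px; apply: (@hdef_rmem k.-1 l); htf_tac.
exists y; split=> [c /yP [] //|].
apply/req_ext => r; split=> [rp|[c [/yP [xc cp] rc]]].
  have [c [xc rc]] := px r rp; exists c; split=> //; apply/yP; split=> //.
  exact: (@rmem_req r (mk c)).
by apply: rmem_req cp; apply: same_sym.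
Qed.

Lemma exists_pw k (x : dom N k) : exists y : dom N k.+1, forall c, eps c y <-> ksub c x.
Proof. by apply: compr; rewrite /ksub; hdef_tac. Qed.

Definition pw k (x : dom N k) : dom N k.+1 :=
  proj1_sig (constructive_indefinite_description _ (exists_pw x)).

Lemma pwP k (x c : dom N k) : eps c (pw x) <-> ksub c x.
Proof. exact: (proj2_sig (constructive_indefinite_description _ (exists_pw x))). Qed.

(** The elements of the value of V at an object of type [k].  The equation for V is a
    definition by recursion on the type, since it expresses the value at an object by
    the values at its elements; at type 0 it is the given function. *)
Fixpoint Vkid k : dom N k -> dom N k.-1 -> Prop :=
  match k return dom N k -> dom N k.-1 -> Prop with
  | 0 => fun x c => hmem c (hV x)
  | j.+1 => fun x y => exists z, eps z x /\ forall c, kid y c -> Vkid z c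
  end.

Lemma VkidE k (x : dom N k) y :
  Vkid x y <-> exists z, kid x z /\ forall c, kid y c -> Vkid z c.
Proof.
by case: k x y => [|k] x y //; split=> [/hV_spec [z ? ?]|[z [? ?]]]; [exists z|apply/hV_spec; exists z].
Qed.

Lemma hdef_Vkid k : forall X (F : family N X) (f : X -> dom N k) g,
  htf F f -> htf F g -> hdef F (fun x => Vkid (f x) (g x)).
Proof.
elim: k => [|k IH] X F f g hf hg; first by rewrite /=; hdef_tac.
by rewrite /=; hdef_tac; apply: IH; htf_tac.
Qed.

Lemma exists_Vo k (x : dom N k) : exists y : dom N k, forall c, kid y c <-> Vkid x c.
Proof.
case: k x => [|k] x; first by exists (hV x).
by apply: (@compr k); apply: hdef_Vkid; htf_tac.
Qed.

Definition Vo k (x : dom N k) : dom N k :=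
  proj1_sig (constructive_indefinite_description _ (exists_Vo x)).

Lemma VoP k (x : dom N k) c : kid (Vo x) c <-> Vkid x c.
Proof. exact: (proj2_sig (constructive_indefinite_description _ (exists_Vo x))). Qed.

Lemma Vo0 (x : dom N 0) : Vo x = hV x.
Proof. by apply: hext => c; apply: (@VoP 0 x c). Qed.

Lemma rmem_Vo p k (x : dom N k) :
  rmem p (mk (Vo x)) <-> exists z, kid x z /\ rsub p (mk (Vo z)).
Proof.
split=> [[c [/VoP /VkidE [z [xz zc]] pc]]|[z [xz /rsub_level [c [cz pc]]]]].
  exists z; split=> // r /(proj1 (req_ext _ (mk c)) pc) [d [cd rd]].
  by exists d; split=> //; apply/VoP/zc.
exists c; split=> //; apply/VoP/VkidE; exists z; split=> // d /cz.
by move/VoP.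
Qed.

Lemma same_Vo k l (x : dom N k) (y : dom N l) : same x y -> same (Vo x) (Vo y).
Proof.
move: k l 0 x y; apply: level_ind => [x y -> //|k l m IH x y /sameE [h1 h2]].
apply/(req_ext (mk _) (mk _)) => p; rewrite !rmem_Vo.
split=> [[z [/h1 [z' [yz' zz']] pz]]|[z' [/h2 [z [xz zz']] pz']]].
  exists z'; split=> // r /pz; exact: (@rmem_reqr (mk _) (mk _) _ (IH _ _ zz')).
exists z; split=> // r /pz'.
exact: (@rmem_reqr (mk _) (mk _) _ (same_sym (IH _ _ zz'))).
Qed.

Definition rP (p : raw) : raw := mk (pw (projT2 p)).
Definition rV (p : raw) : raw := mk (Vo (projT2 p)).

Lemma rmem_rP p q : rmem q (rP p) <-> rsub q p.
Proof.
case: p => k x; split=> [[c [/pwP cx qc]] r|/rsub_level [y [yx qy]]].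
  by move/(proj1 (req_ext _ (mk c)) qc) => [d [/cx cd rd]]; exists d.
by exists y; split=> //; apply/pwP.
Qed.

Lemma rmem_rV p q : rmem q (rV p) <-> exists z, rmem z p /\ rsub q (rV z).
Proof.
case: p => k x; rewrite rmem_Vo; split=> [[z [xz qz]]|[z [[z' [xz' zz']] qz]]].
  by exists (mk z); split=> //; apply: rmem_mk.
exists z'; split=> // r /qz; exact: (@rmem_reqr (mk _) (mk _) _ (same_Vo zz')).
Qed.

Lemma req_rV p q : req p q -> req (rV p) (rV q).
Proof. exact: same_Vo. Qed.

Lemma req_rP p q : req p q -> req (rP p) (rP q).
Proof.
move=> /req_ext pq; apply/req_ext => r; rewrite !rmem_rP.
by split=> rp s /rp /pq.
Qed.

(** * Finite objects *)

(** Finiteness is expressed inside the model: a finite object belongs to every class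
    that contains the empty object and is closed under adjoining elements of it. *)

Definition kid_empty k (y : dom N k) := forall c, ~ kid y c.
Definition kid_adjoin k (y : dom N k) c (y' : dom N k) :=
  forall u, kid y' u <-> kid y u \/ u = c.

Definition inductive_in k (x : dom N k) (C : dom N k.+1) :=
  (forall y, kid_empty y -> eps y C) /\
  (forall y y' c, eps y C -> kid x c -> kid_adjoin y c y' -> eps y' C).

Definition finite k (x : dom N k) := forall C, inductive_in x C -> eps x C.

Lemma hdef_finite X (F : family N X) k (f : X -> dom N k) :
  htf F f -> hdef F (fun x => finite (f x)).
Proof.
move=> hf; rewrite /finite /inductive_in /kid_empty /kid_adjoin; hdef_tac.
Qed.

Lemma finite_ind k (x : dom N k) (R : dom N k -> Prop) : finite x -> hdef1 R ->
  (forall y, kid_empty y -> R y) ->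
  (forall y y' c, R y -> kid x c -> kid_adjoin y c y' -> R y') -> R x.
Proof.
move=> fx /compr [C CP] R0 RS; apply/CP/fx; split=> [y /R0 /CP //|y y' c /CP Ry xc yy'].
by apply/CP; apply: RS Ry xc yy'.
Qed.

Lemma exists_empty_kid k (x : dom N k) : exists y : dom N k, kid_empty y.
Proof.
have [|y yP] := @kid_sep k (fun=> False) x; first by apply: hdef_cst.
by exists y => c /yP [].
Qed.

Lemma kid_empty_eq k (x y : dom N k) : kid_empty x -> kid_empty y -> x = y.
Proof. by move=> x0 y0; apply: kid_ext => c; split=> [/x0|/y0]. Qed.

(** Induction on [z] with the intersection of [z] and [y] in place of [z]. *)
Lemma finite_sub k (x y : dom N k) : finite x -> ksub y x -> finite y.
Proof.
move=> fx yx C [C0 CS].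
pose R z := forall w, (forall u, kid w u <-> kid z u /\ kid y u) -> eps w C.
have hR : hdef1 R by rewrite /hdef1 /R; hdef_tac.
apply: (finite_ind fx hR) => [z z0 w wz|z z' c zR xc zz' w wz|]; last first.
- by move=> u; split=> [yu|[]//]; split=> //; apply: yx.
- have [|v vP] := @kid_sep k (kid y) z; first by rewrite /hdef1; hdef_tac.
  case: (classic (kid y c)) => yc.
    apply: (CS v w c (zR v vP) yc) => u; rewrite wz zz' vP.
    split=> [h|[h|->]]; by tauto.
  have -> // : w = v; last exact: zR.
  apply: kid_ext => u; rewrite wz zz' vP.
  by split=> [[[zu|->] yu]|[zu yu]] //; split=> //; left.
by apply: C0 => u /wz [/z0].
Qed.

Lemma finite_adjoin k (x x' : dom N k) c : finite x -> kid_adjoin x c x' -> finite x'.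
Proof.
move=> fx xx' C [C0 CS]; apply: (CS x x' c _ _ xx'); last by apply/xx'; right.
by apply: fx; split=> // y y' d yC xd; apply: CS yC _; apply/xx'; left.
Qed.

Lemma exists_adjoin k (x y : dom N k) c : ksub y x -> kid x c ->
  exists y', kid_adjoin y c y'.
Proof.
move=> yx xc; have [|y' y'P] := @kid_sep k (fun u => kid y u \/ u = c) x.
  by rewrite /hdef1; hdef_tac.
by exists y' => u; rewrite y'P; split=> [[]//|h]; split=> //; case: h => [/yx|->].
Qed.

(** When [c] is adjoined to [z], the new subsets arise from the old ones by adjoining
    [c].  They are adjoined to [pw z] one after the other, which is an inner induction
    over the finite object [pw z]. *)
Lemma finite_pw k (x : dom N k) : finite x -> finite (pw x).
Proof.
move=> fx; pose R (z : dom N k) := ksub z x ->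
  forall p : dom N k.+1, (forall c, eps c p <-> ksub c z) -> finite p.
have hR : hdef1 R.
  by rewrite /hdef1 /R /ksub; hdef_tac; apply: hdef_finite; htf_tac.
have := finite_ind fx hR; rewrite {1}/R; apply=> //; last by move=> c; apply: pwP.
- move=> z z0 _ p pP; have [e e0] := exists_empty_kid p.
  have fe : finite e by move=> C [C0 _]; apply: C0.
  apply: (@finite_adjoin k.+1 e p z fe) => u; rewrite /= pP; split=> [uz|[/e0 //|->] //].
  by right; apply: kid_empty_eq => // c /uz /z0.
move=> z z' c zR xc zz' z'x p pP.
have zz'_sub : ksub z z' by move=> u zu; apply/zz'; left.
have zx : ksub z x by move=> u /zz'_sub /z'x.
have fz : finite (pw z) by apply: zR => // u; apply: pwP.
(* [b] runs through the sets of those subsets to which [c] has been adjoined. *)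
pose S (b : dom N k.+1) := ksub b (pw z) -> forall q : dom N k.+1,
  (forall y', eps y' q <-> ksub y' z \/ exists y, eps y b /\ kid_adjoin y c y') -> finite q.
have hS : hdef1 S.
  rewrite /hdef1 /S /ksub /kid_adjoin; hdef_tac; apply: hdef_finite; htf_tac.
have := finite_ind fz hS; rewrite {1}/S; apply=> //.
- move=> b b0 _ q qP; have -> // : q = pw z.
  apply: hext_type => u; rewrite qP pwP; split=> [[//|[y [/b0 //]]]|]; by left.
- move=> b b' y bS yz bb' b'z q qP.
  have bz : ksub b (pw z) by move=> u bu; apply: b'z; apply/bb'; left.
  have [|r rP] := @compr k (fun y' => ksub y' z \/ exists y, eps y b /\ kid_adjoin y c y').
    by rewrite /hdef1 /ksub /kid_adjoin; hdef_tac.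
  have [y1 y1P] : exists y1, kid_adjoin y c y1.
    apply: exists_adjoin xc; move: yz => /pwP yz u /yz; exact: zx.
  apply: (@finite_adjoin k.+1 r q y1); first exact: bS bz _ rP.
  move=> u; rewrite /= qP rP; split=> [[uz|[v [/bb' [bv|->] vu]]]|[[uz|[v [bv vu]]]|->]].
  + by left; left.
  + by left; right; exists v.
  + by right; apply: kid_ext => d; rewrite y1P vu.
  + by left.
  + by right; exists v; split=> //; apply/bb'; left.
  + by right; exists y; split=> //; apply/bb'; right.
move=> y'; rewrite pP; split=> [y'z|[y'z|[y [/pwP yz yy']]]].
- case: (classic (kid y' c)) => y'c; last first.
    by left=> u y'u; have /zz' [//|uc] := y'z u y'u; case: y'c; rewrite -uc.
  have [|y yP] := @kid_sep k (kid z) y'; first by rewrite /hdef1; hdef_tac.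
  right; exists y; split=> [|u]; first by apply/pwP => u /yP [].
  rewrite yP; split=> [y'u|[[]//|->]//]; have /zz' [zu|->] := y'z u y'u; by [left|right].
- by move=> u /y'z; apply: zz'_sub.
by move=> u /yy' [/yz|->]; [apply: zz'_sub|apply/zz'; right].
Qed.

(** The power set of an object of type 0 has type 1; a set of type 0 with the same
    elements is finite with it. *)
Lemma finite_type0 (x : dom N 0) (y : dom N 1) :
  (forall c, eps c y <-> hmem c x) -> finite y -> finite x.
Proof.
move=> xy fy C [C0 CS].
pose R (z : dom N 1) := forall w, (forall c, hmem c w <-> eps c z) -> eps w C.
have hR : hdef1 R by rewrite /hdef1 /R; hdef_tac.
apply: (finite_ind fy hR) => [z z0 w wz|z z' c zR yc zz' w wz|c]; last by rewrite xy.
  by apply: C0 => c /wz /z0.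
have [|v vP] := @hsep (fun u => eps u z) w; first by rewrite /hdef1; hdef_tac.
have vz u : hmem u v <-> eps u z.
  by rewrite vP; split=> [[]//|zu]; split=> //; apply/wz/zz'; left.
apply: (CS v w c); [exact: zR|by apply/xy|move=> u /=].
by rewrite wz vz; apply: zz'.
Qed.

(** * Bounded formulas over the hierarchy *)

Definition rawM : structure (set_sig fun_EA) :=
  @Structure (set_sig fun_EA) (fun=> raw) (fun=> req)
    (fun f p => match f with eV => rV p | eP => rP p end) (fun=> rmem).

Lemma rawM_congruent : congruent rawM.
Proof.
split=> /= [_ x|_ x y z xy yz|[] x y|_ x x' y y' xx' yy' xy].
- exact: same_refl.
- exact: same_trans (same_sym xy) yz.
- exact: req_rV.
- exact: req_rP.
exact: rmem_reqr yy' (rmem_req xx' xy).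
Qed.

(** The power set and the extension of V to higher types are not given by terms of H^ω,
    but their graphs are definable.  The quantification over the contexts [Y] that map
    to [X] makes [graph_def] stable under the introduction of variables. *)
Definition pulls X (F : family N X) Y (F' : family N Y) (h : Y -> X) :=
  forall k (f : X -> dom N k), htf F f -> htf F' (fun y => f (h y)).

Definition graph_def X (F : family N X) k (g : X -> dom N k) :=
  forall Y (F' : family N Y) (h : Y -> X) (d : Y -> dom N k),
    pulls F F' h -> htf F' d -> hdef F' (fun y => d y = g (h y)).

Lemma pulls_fst X (F : family N X) Y (F' : family N Y) (h : Y -> X) n :
  pulls F F' h -> pulls F (@hcons _ F' n) (fun q => h q.1).
Proof. by move=> hF k f /hF hf; apply: htf_cons. Qed.

Lemma graph_def_htf X (F : family N X) k (g : X -> dom N k) : htf F g -> graph_def F g.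
Proof. by move=> hg Y F' h d /(_ _ _ hg) hF hd; apply: hdef_eq. Qed.

Lemma graph_def_fst X (F : family N X) k n (g : X -> dom N k) :
  graph_def F g -> graph_def (@hcons _ F n) (fun p => g p.1).
Proof.
move=> hg Y F' h d hF hd; apply: (hg _ _ (fun y => (h y).1)) => // m f hf.
by apply: (hF _ (fun p => f p.1)); apply: htf_cons.
Qed.

Lemma hdef_graph X (F : family N X) k (g : X -> dom N k) (R : X -> dom N k -> Prop) :
  graph_def F g -> hdef (@hcons _ F k) (fun p => R p.1 p.2) -> hdef F (fun x => R x (g x)).
Proof.
move=> hg hR; apply: (@hdef_ext _ _ (fun x => exists d, d = g x /\ R x d)).
  by move=> x; split=> [[d [->]]|] //; exists (g x).
apply: hdef_ex; apply: hdef_and => //.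
by apply: hg; [apply: (@pulls_fst _ _ _ _ id)|apply: htf_last].
Qed.

Lemma graph_def_pw X (F : family N X) k (g : X -> dom N k) :
  graph_def F g -> graph_def F (fun x => pw (g x)).
Proof.
move=> hg Y F' h d hF hd.
apply: (@hdef_ext _ _ (fun y => exists z, z = g (h y) /\ forall c, eps c (d y) <-> ksub c z)).
  move=> y; split=> [[z [-> e]]|->].
    by apply: hext_type => c; rewrite e pwP.
  by exists (g (h y)); split=> // c; rewrite pwP.
apply: hdef_ex; apply: hdef_and; last by rewrite /ksub; hdef_tac.
by apply: (hg _ _ (fun q => h q.1)); [apply: pulls_fst|apply: htf_last].
Qed.

Lemma graph_def_Vo X (F : family N X) k (g : X -> dom N k) :
  graph_def F g -> graph_def F (fun x => Vo (g x)).
Proof.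
move=> hg Y F' h d hF hd.
apply: (@hdef_ext _ _ (fun y => exists z, z = g (h y) /\ forall c, kid (d y) c <-> Vkid z c)).
  move=> y; split=> [[z [-> e]]|->].
    by apply: kid_ext => c; rewrite e VoP.
  by exists (g (h y)); split=> // c; rewrite VoP.
apply: hdef_ex; apply: hdef_and; last first.
  by apply: hdef_all; apply: hdef_and; apply: hdef_imp;
    (apply: hdef_kid || apply: hdef_Vkid); htf_tac.
by apply: (hg _ _ (fun q => h q.1)); [apply: pulls_fst|apply: htf_last].
Qed.

(** The type of the values is fixed, and so is the type of every term and of every
    bounded variable of a formula. *)
Definition leveled X (F : family N X) (p : X -> raw) :=
  exists k (g : X -> dom N k), htf F g /\ forall x, p x = mk (g x).

Lemma leveled_eval X (F : family N X) (e : X -> env rawM) :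
  (forall i, leveled F (fun x => e x tt i)) -> forall t : sterm fun_EA,
  exists k (g : X -> dom N k), graph_def F g /\ forall x, eval (e x) t = mk (g x) :> raw.
Proof.
move=> eF t; suff h s (u : @term (set_sig fun_EA) s) : exists k (g : X -> dom N k),
    graph_def F g /\ forall x, eval (e x) u = mk (g x) :> raw by apply: h.
elim: u => [[] i|f u [k [g [hg ug]]]].
  by have [k [g [hg eg]]] := eF i; exists k, g; split=> //; apply: graph_def_htf.
case: f u ug => u ug.
  by exists k, (fun x => Vo (g x)); split=> [|x]; [apply: graph_def_Vo|rewrite /= ug].
by exists k.+1, (fun x => pw (g x)); split=> [|x]; [apply: graph_def_pw|rewrite /= ug].
Qed.

Definition rcons (p : raw) (e : env rawM) : env rawM := @econs _ _ rawM tt p e.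

Lemma sat_rcons_req p q e A : req p q -> sat (rcons p e) A <-> sat (rcons q e) A.
Proof.
move=> pq; apply: sat_deq; first exact: rawM_congruent.
by apply: deq_econs => //= s i; apply: same_refl.
Qed.

Lemma eval_rcons_slift p (e : env rawM) (t : sterm fun_EA) :
  eval (rcons p e) (slift t) = eval e t.
Proof. by rewrite /slift eval_ren econs_shift. Qed.

Lemma sat_raw_Ball (e : env rawM) (t : sterm fun_EA) A k (x : dom N k) :
  eval e t = mk x :> raw ->
  sat e (sBall t A) <-> forall c, kid x c -> sat (rcons (mk c) e) A.
Proof.
move=> tx; split=> [h c xc|h p].
  apply: (h (mk c)); rewrite /= -/(rcons _ _) eval_rcons_slift tx; exact: rmem_mk.
rewrite /= -/(rcons _ _) eval_rcons_slift tx => -[c [xc pc]].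
by apply/(@sat_rcons_req p (mk c)) => //; apply: h.
Qed.

Lemma sat_raw_Bex (e : env rawM) (t : sterm fun_EA) A k (x : dom N k) :
  eval e t = mk x :> raw ->
  sat e (sBex t A) <-> exists c, kid x c /\ sat (rcons (mk c) e) A.
Proof.
move=> tx; split=> [[p]|[c [xc h]]].
  rewrite /= -/(rcons _ _) eval_rcons_slift tx => -[[c [xc pc]] h].
  by exists c; split=> //; apply/(@sat_rcons_req p (mk c)).
exists (mk c); rewrite /= -/(rcons _ _) eval_rcons_slift tx.
by split=> //; apply: rmem_mk.
Qed.

Lemma leveled_rcons X (F : family N X) (e : X -> env rawM) k :
  (forall i, leveled F (fun x => e x tt i)) ->
  forall i, leveled (@hcons _ F k) (fun p => rcons (mk p.2) (e p.1) tt i).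
Proof.
move=> eF [|i]; first by exists k, (fun p => p.2); split=> //; apply: htf_last.
have [l [g [hg eg]]] := eF i; exists l, (fun p => g p.1); split=> [|p]; last exact: eg.
by apply: htf_cons.
Qed.

(** A bounded quantifier over the elements of an object ranges over one single type. *)
Lemma hdef_sat_raw A : Delta0 A -> forall X (F : family N X) (e : X -> env rawM),
  (forall i, leveled F (fun x => e x tt i)) -> hdef F (fun x => sat (e x) A).
Proof.
elim=> {A} [t u|t u||A B _ IA _ IB|A B _ IA _ IB|A B _ IA _ IB|t A _ IA|t A _ IA] X F e eF.
- have [k [g [hg tg]]] := leveled_eval eF t; have [l [h [hh uh]]] := leveled_eval eF u.
  apply: (@hdef_ext _ _ (fun x => same (g x) (h x))).
    by move=> x; rewrite /= tg uh.
  apply: (hdef_graph (R := fun x d => same d (h x)) hg).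
  apply: (hdef_graph (R := fun p d => same p.2 d) (graph_def_fst hh)).
  by apply: hdef_same; htf_tac.
- have [k [g [hg tg]]] := leveled_eval eF t; have [l [h [hh uh]]] := leveled_eval eF u.
  apply: (@hdef_ext _ _ (fun x => rmem (mk (g x)) (mk (h x)))).
    by move=> x; rewrite /= tg uh.
  apply: (hdef_graph (R := fun x d => rmem (mk d) (mk (h x))) hg).
  apply: (hdef_graph (R := fun p d => rmem (mk p.2) (mk d)) (graph_def_fst hh)).
  by apply: hdef_rmem; htf_tac.
- exact: hdef_cst.
- by apply: hdef_imp; [apply: IA|apply: IB].
- by apply: hdef_and; [apply: IA|apply: IB].
- by apply: hdef_or; [apply: IA|apply: IB].
- have [k [g [hg tg]]] := leveled_eval eF t.
  apply: (@hdef_ext _ _ (fun x => forall c, kid (g x) c -> sat (rcons (mk c) (e x)) A)).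
    by move=> x; rewrite (sat_raw_Ball _ (tg x)).
  apply: hdef_all; apply: hdef_imp; last exact/IA/leveled_rcons.
  apply: (hdef_graph (R := fun p d => kid d p.2) (graph_def_fst hg)).
  by apply: hdef_kid; htf_tac.
have [k [g [hg tg]]] := leveled_eval eF t.
apply: (@hdef_ext _ _ (fun x => exists c, kid (g x) c /\ sat (rcons (mk c) (e x)) A)).
  by move=> x; rewrite (sat_raw_Bex _ (tg x)).
apply: hdef_ex; apply: hdef_and; last exact/IA/leveled_rcons.
apply: (hdef_graph (R := fun p d => kid d p.2) (graph_def_fst hg)).
by apply: hdef_kid; htf_tac.
Qed.

Lemma hdef1_sat_raw A (e : env rawM) k : Delta0 A ->
  hdef1 (fun c : dom N k => sat (rcons (mk c) e) A).
Proof.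
move=> A0; apply: (@hdef_sat_raw A A0 _ _ (fun p => rcons (mk p.2) e)).
apply: (@leveled_rcons _ _ (fun=> e)) => i.
case: (e tt i) => l x; exists l, (fun=> x); split=> //; exact: htf_cst.
Qed.

(** * A model of EA^set over a finite rank *)

Section Fragment.
Variables (n : dom N 0) (finite_n : finite (hV n)).

Fixpoint top k : dom N k := if k is j.+1 then pw (top j) else hV n.

Definition inU (p : raw) : Prop := ksub (projT2 p) (top (projT1 p)).

Lemma inU_kid k (x : dom N k) c : inU (mk x) -> kid x c -> inU (mk c).
Proof.
case: k x c => [|k] x c xU /xU /=; last by rewrite /inU /= pwP.
exact: htrans_V.
Qed.

Lemma inU_sub k (x y : dom N k) : inU (mk x) -> ksub y x -> inU (mk y).
Proof. by move=> xU yx c /yx /xU. Qed.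

Lemma inU_rP p : inU p -> inU (rP p).
Proof. by case: p => k x xU c /pwP cx; apply/pwP => d /cx /xU. Qed.

Lemma inU_rV p : inU p -> inU (rV p).
Proof.
case: p => k x; elim: k x => [|k IH] x xU c.
  by rewrite /= Vo0 => /(hV_mono xU) /hV_V.
move=> /(proj1 (@VoP k.+1 x c)) [z [zx zc]]; apply/pwP => d /zc dz.
by apply: (IH z); [apply: (inU_kid xU zx)|apply/VoP].
Qed.

Lemma finite_inU k (x : dom N k) : inU (mk x) -> finite x.
Proof.
suff h : finite (top k) by apply: finite_sub.
by elim: k {x} => //= k; apply: finite_pw.
Qed.

Definition fragM : structure (set_sig fun_EA) :=
  @Structure (set_sig fun_EA) (fun=> {p | inU p})
    (fun _ p q => req (sval p) (sval q))
    (fun f p => match f with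
       | eV => exist _ (rV (sval p)) (inU_rV (proj2_sig p))
       | eP => exist _ (rP (sval p)) (inU_rP (proj2_sig p))
       end)
    (fun _ p q => rmem (sval p) (sval q)).

Lemma fragM_congruent : congruent fragM.
Proof.
have [r t f m] := rawM_congruent.
split=> /= [_ x|_ x y z|[] x y|_ x x' y y'].
- exact: (r tt).
- exact: (t tt).
- exact: req_rV.
- exact: req_rP.
exact: (m tt).
Qed.

Definition fvals (e : env fragM) : env rawM := fun s i => sval (e s i).

Lemma fvals_econs (d : dom fragM tt) (e : env fragM) :
  fvals (@econs _ _ fragM tt d e) = rcons (sval d) (fvals e).
Proof.
apply: functional_extensionality_dep => -[]; apply: functional_extensionality => i.
by case: i.
Qed.

Lemma eval_fvals (e : env fragM) s (t : @term (set_sig fun_EA) s) :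
  sval (eval e t) = eval (fvals e) t.
Proof. by elim: t => //= f t <-; case: f t. Qed.

Lemma eval_fvals_mk (e : env fragM) (t : sterm fun_EA) :
  exists k (x : dom N k), inU (mk x) /\ eval (fvals e) t = mk x :> raw.
Proof.
have := proj2_sig (eval e t); rewrite eval_fvals.
by case: (eval (fvals e) t) => k x xU; exists k, x.
Qed.

Lemma sat_frag_ball (e : env fragM) (t : sterm fun_EA) (R : raw -> Prop) k (x : dom N k) :
  (forall p q, req p q -> R p -> R q) ->
  inU (mk x) -> eval (fvals e) t = mk x :> raw ->
  (forall d : dom fragM tt, rmem (sval d) (sval (eval e t)) -> R (sval d)) <->
  (forall c, kid x c -> R (mk c)).
Proof.
move=> Rreq xU tx; rewrite eval_fvals tx; split=> [h c xc|h [p pU] /= [c [xc pc]]].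
  exact: (h (exist _ (mk c) (inU_kid xU xc)) (rmem_mk xc)).
apply: (Rreq (mk c)); first exact: same_sym.
exact: h.
Qed.

(** The fragment is closed under elements, so bounded formulas are absolute. *)
Lemma sat_fvals A : Delta0 A -> forall e : env fragM, sat e A <-> sat (fvals e) A.
Proof.
have Rreq (e : env fragM) B p q : req p q ->
  sat (rcons p (fvals e)) B -> sat (rcons q (fvals e)) B.
  by move=> pq; apply: (proj1 (sat_rcons_req _ _ pq)).
move=> A0; elim: A0 => {A} [t u|t u||A B _ IA _ IB|A B _ IA _ IB|A B _ IA _ IB|t A _ IA|t A _ IA] e.
- by rewrite /= !eval_fvals.
- by rewrite /= !eval_fvals.
- by [].
- by rewrite /= IA IB.
- by rewrite /= IA IB.
- by rewrite /= IA IB.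
- have [k [x [xU tx]]] := eval_fvals_mk e t.
  rewrite (sat_raw_Ball _ tx) -(sat_frag_ball (Rreq e A) xU tx).
  have E d : eval (@econs _ _ fragM tt d e) (slift t) = eval e t.
    by rewrite /slift eval_ren econs_shift.
  split=> h d dt; last by apply/IA; rewrite fvals_econs; apply: h; rewrite -(E d).
  have hd : sat (@econs _ _ fragM tt d e) A by apply: (h d); rewrite /= E.
  by move/IA: hd; rewrite fvals_econs.
have [k [x [xU tx]]] := eval_fvals_mk e t.
have E d : eval (@econs _ _ fragM tt d e) (slift t) = eval e t.
  by rewrite /slift eval_ren econs_shift.
rewrite (sat_raw_Bex _ tx); split=> [[d []]|[c [xc h]]].
  rewrite /= E eval_fvals tx => -[c [xc dc]] hd.
  have /IA : sat (@econs _ _ fragM tt d e) A by exact: hd.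
  by rewrite fvals_econs => h; exists c; split=> //; apply: Rreq h.
exists (exist _ (mk c) (inU_kid xU xc)); split; last first.
  by apply: (proj2 (IA _)); rewrite fvals_econs.
by rewrite /= E eval_fvals tx; apply: rmem_mk.
Qed.

Lemma rsub_inU p q : inU p -> (forall r, inU r -> rmem r p -> rmem r q) -> rsub p q.
Proof.
case: p => k x xU h r [c [xc rc]].
apply: (@rmem_req (mk c)); first exact: same_sym.
by apply: h; [apply: (inU_kid xU xc)|apply: rmem_mk].
Qed.

(** By induction on the level, and by foundation at type 0, the elements of an object
    may be assumed to satisfy the claim; as the object is finite, it is reached from
    the empty one by adjoining these elements. *)
Lemma frag_ind (R : raw -> Prop) :
  (forall p q, req p q -> R p -> R q) ->
  (forall k, hdef1 (fun c : dom N k => R (mk c))) ->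
  (exists p, [/\ inU p, forall q, inU q -> ~ rmem q p & R p]) ->
  (forall p q r, inU p -> inU q -> inU r -> R p -> R q ->
    (forall s, rmem s r <-> rmem s p \/ req s q) -> R r) ->
  forall p, inU p -> R p.
Proof.
move=> Rreq Rdef [e [eU e0 Re]] step.
have R0 k (y : dom N k) : kid_empty y -> R (mk y).
  move=> y0; apply: (Rreq e) => //; apply/req_ext => r; split=> [re|[c [/y0]] //].
  by apply: (@rsub_inU e (mk y) eU _ r re) => s sU /(e0 s sU).
(* [x] is built up from the empty object by adjoining its elements. *)
have build k (x : dom N k) : inU (mk x) -> (forall c, kid x c -> R (mk c)) -> R (mk x).
  move=> xU xR; pose Q (y : dom N k) := ksub y x -> R (mk y).
  have Qdef : hdef1 Q.
    apply: hdef_imp; last exact: Rdef.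
    by rewrite /ksub; hdef_tac.
  have Q0 y : kid_empty y -> Q y by move=> /R0 Ry _.
  suff : Q x by apply.
  apply: (finite_ind (finite_inU xU) Qdef Q0).
  move=> y y' c yQ xc yy' y'x.
  have yx : ksub y x by move=> u yu; apply: y'x; apply/yy'; left.
  apply: (step (mk y) (mk c)); [exact: (inU_sub xU)|exact: (inU_kid xU)|
    exact: (inU_sub xU)|exact: yQ|exact: xR|].
  move=> s; split=> [[d [/yy' [yd|->] sd]]|[[d [yd sd]]|sc]].
  - by left; exists d.
  - by right.
  - by exists d; split=> //; apply/yy'; left.
  by exists c; split=> //; apply/yy'; right.
case=> k; elim: k => [|k IH] x xU; last first.
  by apply: build => // c xc; apply: IH; apply: (inU_kid xU xc).
apply: NNPP => nRx.
have [||y [yU nRy] yP] := @foundation (fun y => inU (mk y) /\ ~ R (mk y)).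
- apply: hdef_and; last by apply: hdef_not; apply: Rdef.
  by rewrite /inU /ksub /=; hdef_tac.
- by exists x.
apply: nRy; apply: build => // c yc; apply: NNPP => nRc.
by apply: (yP c yc); split=> //; apply: (inU_kid yU yc).
Qed.

Lemma fragM_models : models fragM EAset.
Proof.
move=> _ [|A A0|||A A0] e.
- split=> /= [xy d|h].
    by split; apply: rmem_reqr => //; apply: same_sym.
  apply/req_ext => r; split; apply: rsub_inU; try exact: (proj2_sig (e _ _));
    by move=> q qU qx; have [h1 h2] := h (exist _ q qU); apply: h1 || apply: h2.
- have xU := proj2_sig (e tt 0); case Ex: (sval (e tt 0)) xU => [k x] xU.
  have [y yP] := kid_sep x (@hdef1_sat_raw A (fvals e) k.-1 A0).
  have yU : inU (mk y) by apply: inU_sub xU _ => c /yP [].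
  exists (exist _ (mk y) yU) => z.
  pose e2 := @econs _ (@set_sort_dec fun_EA) fragM tt z
    (@econs _ (@set_sort_dec fun_EA) fragM tt (exist _ (mk y) yU) e).
  apply: (iffRL (sat_Iff e2 (sIn (sv 0) (sv 1)) (And (sIn (sv 0) (sv 2)) (at_var 2 0 A)))).
  have -> : sat e2 (And (sIn (sv 0) (sv 2)) (at_var 2 0 A)) <->
    rmem (sval z) (mk x) /\ sat (rcons (sval z) (fvals e)) A.
    rewrite /= sat_at_var Ex; set E := (X in sat X A).
    have -> : E = @econs _ _ fragM tt z e.
      by rewrite /E; congr econs; apply: functional_extensionality_dep => -[].
    by rewrite sat_fvals // fvals_econs.
  split=> [[c [/yP [xc Ac] zc]]|[[c [xc zc]] Az]].
    by split; [exists c|apply/(@sat_rcons_req (sval z) (mk c) (fvals e) A zc)].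
  by exists c; split=> //; apply/yP; split=> //; move/(@sat_rcons_req (sval z) (mk c) (fvals e) A zc): Az.
- split=> /= [/rmem_rP h d /h //|h].
  apply/rmem_rP/rsub_inU; first exact: (proj2_sig (e tt 0)).
  by move=> r rU; apply: (h (exist _ r rU)).
- have xU := proj2_sig (e tt 1); split=> /= [/rmem_rV|[z [zx /rmem_rP yz]]]; last first.
    by apply/rmem_rV; exists (sval z).
  case Ex: (sval (e tt 1)) xU => [k x] xU [z [[c [xc zc]] yz]].
  exists (exist _ (mk c) (inU_kid xU xc)); split; first exact: rmem_mk.
  by apply/rmem_rP => r /yz; apply: rmem_reqr; apply: req_rV.
case=> -[x [x0 Ax]] step d.
have satE (a : dom fragM tt) : sat (@econs _ _ fragM tt a e) A <-> sat (rcons (sval a) (fvals e)) A.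
  by rewrite sat_fvals // fvals_econs.
apply/satE; apply: (frag_ind (R := fun p => sat (rcons p (fvals e)) A)) (proj2_sig d).
- by move=> p q /sat_rcons_req h /h.
- by move=> k; apply: hdef1_sat_raw.
- exists (sval x); split; first exact: (proj2_sig x).
    by move=> q qU; apply: (x0 (exist _ q qU)).
  exact/satE.
move=> p q r pU qU rU Ap Aq pqr.
pose E := @econs _ (@set_sort_dec fun_EA) fragM tt (exist _ r rU) (@econs _ (@set_sort_dec fun_EA) fragM tt
  (exist _ q qU) (@econs _ (@set_sort_dec fun_EA) fragM tt (exist _ p pU) e)).
have atE j : sat E (at_var 3 j A) <-> sat (rcons (sval (E tt j)) (fvals e)) A.
  rewrite sat_at_var -satE; set E' := (X in sat X A).
  have -> // : E' = @econs _ _ fragM tt (E tt j) e.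
  by rewrite /E'; congr econs; apply: functional_extensionality_dep => -[].
apply/(atE 0)/step; split; first exact/(atE 2).
split; first exact/(atE 1).
by move=> s; have [h1 h2] := pqr (sval s); split.
Qed.

End Fragment.

(** * The class HF of a model of H^ω *)

Definition hordinal x := htrans x /\ forall y, hmem y x -> htrans y.

Definition hnatural n := hordinal n /\
  forall b, hordinal b /\ (hmem b n \/ b = n) ->
    (forall c, ~ hmem c b) \/
    exists g, hordinal g /\ forall c, hmem c b <-> hmem c g \/ c = g.

Lemma sat_hNat_iff (e : env N) i : sat e (hNat (v i)) <-> hnatural (e 0 i).
Proof.
have E : @deq _ N 0 = @eq (dom N 0).
  apply: functional_extensionality => x; apply: functional_extensionality => y.
  by apply: propositional_extensionality; apply: strictN.
by rewrite /sat /= E.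
Qed.

Lemma hnatural_empty x : (forall y, ~ hmem y x) -> hnatural x.
Proof.
move=> x0; split; first by split=> y /x0.
by move=> b [_ [/x0 //|->]]; left.
Qed.

(** If [m] is the successor of [g], then [hV m] consists of the subsets of [hV g]. *)
Lemma finite_natural m : hnatural m -> finite (hV m).
Proof.
move: m; apply: hin_ind.
  by rewrite /hdef1 /hnatural /hordinal; hdef_tac; apply: hdef_finite; htf_tac.
move=> m IH [mo mS]; case: (mS m) => [|m0|[g [[gt gtt] mg]]]; first by split; [|right].
  by move=> C [C0 _]; apply: C0 => c /hV_spec [z /m0].
have gm : hmem g m by apply/mg; right.
have ng : hnatural g.
  split=> // b [bo bg]; apply: mS; split=> //; left; apply/mg.
  by case: bg; [left|right].
apply: (finite_type0 (y := pw (hV g))); last exact/finite_pw/IH.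
move=> c; rewrite pwP; split=> [cg|/hV_spec [z /mg [zg|->] cz]]; first exact: mem_hV gm cg.
  by apply: incl_trans cz _; apply: hV_mono; apply: gt.
exact: cz.
Qed.

Lemma sat_hHF_iff (e : env N) :
  sat e (hHF (v 0)) <-> exists m, hnatural m /\ hmem (e 0 0) (hV m).
Proof.
split=> [[m [mN me]]|[m [mN me]]]; exists m; split=> //.
  exact: (proj1 (@sat_hNat_iff (econs m e) 0)).
exact: (proj2 (@sat_hNat_iff (econs m e) 0)).
Qed.

(** Subsets of [hV n] are admitted besides its elements: [hV n] is empty for [n] zero,
    and environments need values. *)
Definition frag_sim (n x : dom N 0) (p : dom (fragM n) tt) : Prop :=
  hsub x (hV n) /\ req (mk (x : dom N 0)) (sval p).

Lemma rmem_type0 (x y : dom N 0) : rmem (mk x) (mk y) <-> hmem x y.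
Proof. by split=> [[c [cy /= ->]]|xy] //; exists x. Qed.

Lemma req_mem_iff p p' q q' : req p p' -> req q q' -> rmem p q <-> rmem p' q'.
Proof.
move=> pp' qq'; split=> h; first exact: rmem_reqr qq' (rmem_req pp' h).
exact: rmem_reqr (same_sym qq') (rmem_req (same_sym pp') h).
Qed.

Lemma frag_transfer n (A : V_form) (e : env N) (e' : env (EA_reduct (fragM n))) :
  hnatural n -> Delta0 A -> (forall i, @frag_sim n (e 0 i) (e' tt i)) ->
  sat e (relHF A) <-> sat e' A.
Proof.
move=> nn A0 ee'.
apply: (@Delta0_transfer N (EA_reduct (fragM n)) (@frag_sim n)) => //.
- move=> x p [xn xp]; split.
    by apply: incl_trans (hV_V (x := n)); apply: hV_mono.
  by have := req_rV xp; rewrite /rV /= (Vo0 x).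
- move=> x p x' p' [_ xp] [_ xp']; split=> [/strictN xx'|pp'].
    rewrite -xx' in xp'; exact: same_trans (same_sym xp) xp'.
  by apply/strictN; apply: (same_trans xp (same_trans pp' (same_sym xp'))).
- move=> x p x' p' [_ xp] [_ xp']; rewrite -[rint _ _]/(hmem x x') -rmem_type0.
  exact: req_mem_iff.
- move=> x [p pU] x' [xn xp] x'x; have x'n := htrans_V (xn _ x'x).
  exists (exist _ (mk (x' : dom N 0)) x'n); first by split=> //; apply: same_refl.
  by apply: (rmem_reqr xp); apply/rmem_type0.
move=> x [p pU] [p' p'U] [xn xp] /= p'p.
have [c [cx p'c]] : rmem p' (mk x) by apply: rmem_reqr p'p; apply: same_sym.
exists c; split=> //.
  by move=> e1 e1c; apply/sat_hHF_iff; exists n; rewrite e1c; split=> //; apply: xn.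
split; first by apply: htrans_V; apply: xn.
exact: same_sym.
Qed.

(** A tuple of members of HF is contained in a single [hV n] with [n] natural, by
    comparability. *)
Lemma frag_Pi1 (A : V_form) : Pi1 A -> forall e : env N,
  (exists n, hnatural n /\ forall i, hsub (e 0 i) (hV n)) ->
  (forall n (e' : env (EA_reduct (fragM n))), hnatural n ->
    (forall i, @frag_sim n (e 0 i) (e' tt i)) -> sat e' A) ->
  sat e (relHF A).
Proof.
elim=> {A} [A A0|A _ IH] e [n [nn en]] h.
  pose e' : env (EA_reduct (fragM n)) := fun s i => exist _ (mk (e 0 i)) (en i).
  have ee' i : @frag_sim n (e 0 i) (e' tt i) by split=> //; apply: same_refl.
  by apply/(frag_transfer nn A0 ee'); apply: h.
move=> d /(proj1 (sat_hHF_iff _)) [m [nm dm]]; apply: IH => [|k e' nk de'].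
  case: (hV_compare n m) => [/htrans_V mn|nm'].
    exists n; split=> // -[|i]; last exact: en.
    by apply: incl_trans mn; apply: htrans_V.
  exists m; split=> // -[|i]; first exact: (htrans_V dm).
  exact: incl_trans (en i) nm'.
pose e1 : env (EA_reduct (fragM k)) := fun s i => e' tt i.+1.
have e1_cons : @econs _ _ (EA_reduct (fragM k)) tt (e' tt 0) e1 = e'.
  apply: functional_extensionality_dep => -[].
  by apply: functional_extensionality => -[].
have h1 : sat e1 (sAll A) by apply: h => // i; apply: (de' i.+1).
by have := h1 (e' tt 0); rewrite e1_cons.
Qed.

(** As [A] is a sentence, the environment may be taken to be constantly empty, which is
    below the rank of the natural number zero. *)
Lemma sat_of_EA_provable (A : V_form) (e : env N) :
  sentence A -> Pi1 A -> provable EAset (V_to_EA A) -> sat e (relHF A).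
Proof.
move=> cA pA HA.
have [|o oP] := @hsep (fun=> False) (hpt 0); first exact: hdef_cst.
have o0 y : ~ hmem y o by move=> /oP [].
pose e0 : env N := fun s => match s return nat -> dom N s with
  0 => fun=> o | s => fun=> hpt s end.
apply: (proj2 (@sat_sentence _ _ N (relHF A) e e0 (sentence_relHF cA))).
apply: frag_Pi1 => //.
  by exists o; split=> [|i y /o0 //]; apply: hnatural_empty.
move=> n e' nn _; apply/sat_V_to_EA.
apply: (soundness (@fragM_congruent n) (fragM_models (finite_natural nn)) HA) => B [].
Qed.

End HModel.

Theorem proposition3p2 (phi : V_form) (phi_sentence : sentence phi)
    (phi_Pi1 : Pi1 phi) :
  (Homega ⊢ relHF phi) <-> (EAset ⊢ V_to_EA phi).
Proof.
split=> h.
  apply: (@set_completeness fun_EA (fun f => if f is eV then 0 else 1)); first by case=> -[].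
  move=> M strictM EA_M e.
  exact: (sat_of_H_provable strictM EA_M (e tt 0)).
apply: H_completeness => N strictN H_N e.
exact: (sat_of_EA_provable strictN H_N (fun s => e s 0)).
Qed.
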